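(* There is an algorithm that, given an instance $I=(\mathcal{G},s,X,k)$ of \textsc{$k$-fixed TEXP}, decides whether $I$ is a yes-instance and, if it is, returns an optimal solution (an $(s,1,X)$-tour of minimum arrival time), in time $O(2^k k L n^2)$, where $n=|V(\mathcal{G})|$ and $L$ is the lifetime of $\mathcal{G}$.
   Context: A temporal graph $\mathcal{G}=\langle G_1,\dots,G_L\rangle$ with underlying simple undirected graph $G=(V,E)$, $|V|=n$, and lifetime $L$ is a sequence of graphs $G_t=(V,E_t)$ with $E_t\subseteq E$ for $t\in[L]$; a pair $(e,t)$ with $e\in E_t$ is a time edge. A strict temporal walk is a start time $t_0$ together with an alternating sequence $v_1,(e_1,t_1),v_2,\dots,(e_{l-1},t_{l-1}),v_l$ with $e_i=\{v_i,v_{i+1}\}\in E_{t_i}$ and $1\le t_0\le t_1<t_2<\dots<t_{l-1}\le L$; it starts at $v_1$ at time $t_0$ and visits every $v_i$. For $v\in V$, $t\in[L]$, $X\subseteq V$, a $(v,t,X)$-tour is a strict temporal walk starting at $v$ with start time $t$ that visits every vertex of $X$; its arrival time is the timestep after the timestep at the end of which it has for the first time visited all vertices of $X$. An instance of \textsc{$k$-fixed TEXP} is $(\mathcal{G},s,X,k)$ with $s\in V$ and $X\subseteq V$, $|X|=k$; it is a yes-instance iff an $(s,1,X)$-tour exists in $\mathcal{G}$. An optimal solution of a yes-instance is such a tour of minimum arrival time. *)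

(* Defs.v *)
From Stdlib Require Import Arith List Lia.
Import ListNotations.

(* A temporal graph with vertex set V = {0,..,n-1} and lifetime L.
   tg_edge t u v = true  iff  {u,v} is an edge of G_t. *)
Record tgraph := TGraph {
  tg_n : nat;
  tg_L : nat;
  tg_edge : nat -> nat -> nat -> bool
}.

(* Well-formedness: every G_t (1 <= t <= L) is a simple undirected graph on V;
   the underlying graph G is the union of the E_t, so E_t ⊆ E holds. *)
Definition tgraph_wf (G : tgraph) : Prop :=
  (forall t u v, tg_edge G t u v = true ->
     1 <= t <= tg_L G /\ u < tg_n G /\ v < tg_n G /\ u <> v) /\
  (forall t u v, tg_edge G t u v = tg_edge G t v u).

(* A strict temporal walk starting at v1 with start time t0 is encoded by
   v1, t0 and the list of steps [(t1,v2); (t2,v3); ...; (t_{l-1},v_l)],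
   where step (t_i, v_{i+1}) traverses the time edge ({v_i,v_{i+1}}, t_i). *)

Fixpoint valid_steps (G : tgraph) (u lb : nat) (steps : list (nat * nat)) : Prop :=
  match steps with
  | [] => True
  | (t, v) :: r =>
      lb <= t /\ t <= tg_L G /\ tg_edge G t u v = true /\ valid_steps G v (S t) r
  end.

Definition strict_walk (G : tgraph) (v1 t0 : nat) (steps : list (nat * nat)) : Prop :=
  1 <= t0 <= tg_L G /\ v1 < tg_n G /\ valid_steps G v1 t0 steps.

Definition visited (v1 : nat) (steps : list (nat * nat)) : list nat :=
  v1 :: map snd steps.

Definition tour (G : tgraph) (v t : nat) (X : list nat) (steps : list (nat * nat)) : Prop :=
  strict_walk G v t steps /\ (forall x, In x X -> In x (visited v steps)).

Definition covers (X seen : list nat) : bool :=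
  forallb (fun x => existsb (Nat.eqb x) seen) X.

(* The walk is at v1 at time t0 and, after traversing ({v_i,v_{i+1}}, t_i),
   at v_{i+1} at time t_i + 1.  The arrival time is the time at which the walk
   is at the vertex with which it has visited all of X for the first time,
   i.e. the timestep after the timestep at the end of which X is covered
   (and t0 if X is already covered by the start vertex). *)
Fixpoint arrival_aux (X seen : list nat) (time : nat) (steps : list (nat * nat))
  : option nat :=
  if covers X seen then Some time
  else match steps with
       | [] => None
       | (t, w) :: r => arrival_aux X (w :: seen) (S t) r
       end.

Definition arrival (X : list nat) (v1 t0 : nat) (steps : list (nat * nat)) : option nat :=
  arrival_aux X [v1] t0 steps.

Record instance := Inst {
  i_G : tgraph;
  i_s : nat;
  i_X : list nat
}.

Definition i_k (I : instance) : nat := length (i_X I).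

Definition instance_wf (I : instance) : Prop :=
  tgraph_wf (i_G I) /\ i_s I < tg_n (i_G I) /\ NoDup (i_X I) /\
  (forall x, In x (i_X I) -> x < tg_n (i_G I)).

Definition yes_instance (I : instance) : Prop :=
  exists steps, tour (i_G I) (i_s I) 1 (i_X I) steps.

Definition optimal_solution (I : instance) (steps : list (nat * nat)) : Prop :=
  tour (i_G I) (i_s I) 1 (i_X I) steps /\
  forall steps', tour (i_G I) (i_s I) 1 (i_X I) steps' ->
    forall a a', arrival (i_X I) (i_s I) 1 steps = Some a ->
                 arrival (i_X I) (i_s I) 1 steps' = Some a' -> a <= a'.

(* Machine model: unit-cost RAM with one memory array of naturals.         *)
(* Word size is enforced by requiring (in the theorem) that every value    *)
(* written stays polynomially bounded in the size parameters.              *)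

Inductive instr :=
| IConst (a c : nat)
| IAdd (a b c : nat)
| ISub (a b c : nat)        (* M[a] := M[b] - M[c] (trunc.)  *)
| IMul (a b c : nat)
| IDiv (a b c : nat)        (* M[a] := M[b] / M[c] (x/0 = 0) *)
| IMod (a b c : nat)
| ILoad (a b : nat)
| IStore (a b : nat)
| IJmpZ (a l : nat)
| IJmpLt (a b l : nat)
| IHalt.

Definition program := list instr.

Record mstate := MState { pc : nat; mem : nat -> nat }.

Definition upd (m : nat -> nat) (a v : nat) : nat -> nat :=
  fun x => if Nat.eqb x a then v else m x.

Definition halted (P : program) (st : mstate) : Prop :=
  match nth_error P (pc st) with
  | None | Some IHalt => True
  | Some _ => False
  end.

Definition step (P : program) (st : mstate) : mstate :=
  let m := mem st in
  let nx := S (pc st) in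
  match nth_error P (pc st) with
  | None | Some IHalt => st
  | Some (IConst a c) => MState nx (upd m a c)
  | Some (IAdd a b c) => MState nx (upd m a (m b + m c))
  | Some (ISub a b c) => MState nx (upd m a (m b - m c))
  | Some (IMul a b c) => MState nx (upd m a (m b * m c))
  | Some (IDiv a b c) => MState nx (upd m a (m b / m c))
  | Some (IMod a b c) => MState nx (upd m a (m b mod m c))
  | Some (ILoad a b) => MState nx (upd m a (m (m b)))
  | Some (IStore a b) => MState nx (upd m (m a) (m b))
  | Some (IJmpZ a l) => MState (if Nat.eqb (m a) 0 then l else nx) m
  | Some (IJmpLt a b l) => MState (if Nat.ltb (m a) (m b) then l else nx) m
  end.

Definition written_value (P : program) (st : mstate) : nat :=
  let m := mem st in
  match nth_error P (pc st) with
  | Some (IConst _ c) => c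
  | Some (IAdd _ b c) => m b + m c
  | Some (ISub _ b c) => m b - m c
  | Some (IMul _ b c) => m b * m c
  | Some (IDiv _ b c) => m b / m c
  | Some (IMod _ b c) => m b mod m c
  | Some (ILoad _ b) => m (m b)
  | Some (IStore _ b) => m b
  | _ => 0
  end.

Fixpoint exec (P : program) (fuel : nat) (st : mstate) : mstate :=
  match fuel with
  | 0 => st
  | S f => exec P f (step P st)
  end.

(* Input encoding: M[0] = n, M[1] = L, M[2] = s, M[3] = k,
   M[4 .. 4+k-1] = the elements of X,
   M[4+k + (t-1)*n*n + u*n + v] = [ {u,v} ∈ E_t ] for 1 <= t <= L, u,v < n,
   all other cells 0.  The program starts at pc = 0. *)
Definition encode (I : instance) : nat -> nat :=
  let G := i_G I in
  let n := tg_n G in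
  let L := tg_L G in
  let k := i_k I in
  fun a =>
    if Nat.eqb a 0 then n
    else if Nat.eqb a 1 then L
    else if Nat.eqb a 2 then i_s I
    else if Nat.eqb a 3 then k
    else if Nat.ltb a (4 + k) then nth (a - 4) (i_X I) 0
    else if Nat.ltb a (4 + k + L * (n * n)) then
      let b := a - (4 + k) in
      let t := S (b / (n * n)) in
      let r := b mod (n * n) in
      if tg_edge G t (r / n) (r mod n) then 1 else 0
    else 0.

Definition init_state (I : instance) : mstate := MState 0 (encode I).

(* Output decoding: M[0] = 1 (yes) or 0 (no); if yes, M[1] = number of steps l
   and the tour (start vertex s, start time 1) has steps
   (M[2+2i], M[3+2i]) for i < l. *)
Definition decode_steps (m : nat -> nat) : list (nat * nat) :=
  map (fun i => (m (2 + 2 * i), m (3 + 2 * i))) (seq 0 (m 1)).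

Definition correct_output (I : instance) (m : nat -> nat) : Prop :=
  (yes_instance I -> m 0 = 1 /\ optimal_solution I (decode_steps m)) /\
  (~ yes_instance I -> m 0 = 0).

(* Main.v *)
Require Import Defs.
From Stdlib Require Import Arith List Lia Bool.
Import ListNotations.

(** Process the time steps backwards. For a vertex [v], a time [t] and a set [R] of targets still
    to be visited (a bit mask below [2 ^ k]), the least arrival time of a continuation depends only
    on the values at time [t + 1]: wait at [v], or traverse an edge [{v, u}] of [G_t] and drop [u]
    from [R]. There are [(L + 1) n 2^k] states with at most [n + 1] alternatives each, hence
    [O(2^k L n^2)] operations; storing an optimal alternative for each state lets one read off
    an optimal tour in [O(L)] further steps.

    The program is written in a small language of assignments, conditionals and counted loops,
    which is compiled to the RAM. The input may occupy every directly addressable cell, so the low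
    cells are first moved beyond the input to make room for the variables. *)

(** * Dynamic programme on bit masks *)

Fixpoint target_bit (X : list nat) (x : nat) : nat :=
  match X with
  | [] => 0
  | y :: l => if x =? y then 1 else 2 * target_bit l x
  end.

Lemma target_bit_not_in X x : ~ In x X -> target_bit X x = 0.
Proof.
  induction X as [|y l IH]; cbn; intro Hx; [reflexivity|].
  destruct (Nat.eqb_spec x y); [subst; tauto|].
  rewrite IH by tauto. reflexivity.
Qed.

Lemma target_bit_nth X i d : NoDup X -> i < length X -> target_bit X (nth i X d) = 2 ^ i.
Proof.
  revert i. induction X as [|y l IH]; intros i ND Hi; cbn in Hi; [lia|].
  inversion_clear ND as [|? ? Hy ND']. destruct i; cbn [target_bit nth].
  - now rewrite Nat.eqb_refl.
  - destruct (Nat.eqb_spec (nth i l d) y) as [<-|_].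
    + exfalso. apply Hy, nth_In. lia.
    + rewrite IH by (trivial; lia). reflexivity.
Qed.

(* For [b = 2 ^ i] this clears bit [i] of [R]; since [R / 0 = 0], it is the identity for [b = 0],
   the value of [target_bit X] outside [X]. *)
Definition clear (R b : nat) : nat := R - (R / b) mod 2 * b.

Lemma clear_le R b : clear R b <= R.
Proof. unfold clear; lia. Qed.

Lemma clear_0_r R : clear R 0 = R.
Proof. unfold clear; simpl; lia. Qed.

Lemma testbit_clear R i j :
  Nat.testbit (clear R (2 ^ i)) j = Nat.testbit R j && negb (i =? j).
Proof.
  unfold clear. rewrite <- Nat.testbit_spec'.
  destruct (Nat.testbit R i) eqn:E; cbn [Nat.b2n].
  - rewrite Nat.mul_1_l, Nat.sub_nocarry_ldiff.
    + now rewrite Nat.ldiff_spec, Nat.pow2_bits_eqb.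
    + apply Nat.bits_inj. intro l.
      rewrite Nat.ldiff_spec, Nat.pow2_bits_eqb, Nat.bits_0.
      destruct (Nat.eqb_spec i l); subst; rewrite ?E; reflexivity.
  - rewrite Nat.mul_0_l, Nat.sub_0_r.
    destruct (Nat.eqb_spec i j); subst; rewrite ?E; cbn; now rewrite ?andb_true_r.
Qed.

Fixpoint argmax (f : nat -> nat) (init : nat * nat) (m : nat) : nat * nat :=
  match m with
  | 0 => init
  | S u => let p := argmax f init u in if fst p <? f u then (f u, u) else p
  end.

Lemma argmax_spec f init m :
  let p := argmax f init m in
  fst init <= fst p /\
  (forall u, u < m -> f u <= fst p) /\
  (p = init \/ snd p < m /\ fst init < fst p /\ fst p = f (snd p)).
Proof.
  induction m as [|m (Hinit & Hmax & Hatt)]; cbn zeta in *; cbn [argmax].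
  - repeat split; [lia|lia|now left].
  - destruct (Nat.ltb_spec (fst (argmax f init m)) (f m)) as [Hlt|Hle]; cbn [fst snd].
    + split; [lia|]. split; [|right; lia].
      intros u Hu. destruct (Nat.eq_dec u m) as [->|]; [lia|].
      specialize (Hmax u ltac:(lia)). lia.
    + split; [lia|]. split; [|destruct Hatt as [|]; [now left|right; lia]].
      intros u Hu. destruct (Nat.eq_dec u m) as [->|]; [lia|]. apply Hmax. lia.
Qed.

Definition edge_bit (G : tgraph) (t u v : nat) : nat :=
  if tg_edge G t u v then 1 else 0.

Lemma edge_bit_le G t u v : edge_bit G t u v <= 1.
Proof. unfold edge_bit; destruct (tg_edge _ _ _ _); lia. Qed.

Lemma covers_spec X seen : covers X seen = true <-> incl X seen.
Proof.
  unfold covers, incl. rewrite forallb_forall. split; intros H x Hx; specialize (H x Hx).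
  - apply existsb_exists in H as (y & Hy & E). apply Nat.eqb_eq in E. now subst.
  - apply existsb_exists. exists x. now rewrite Nat.eqb_refl.
Qed.

Lemma arrival_aux_defined X seen t steps :
  (exists a, arrival_aux X seen t steps = Some a) <-> incl X (seen ++ map snd steps).
Proof.
  revert seen t. induction steps as [|[t1 w] l IH]; intros seen t; cbn [arrival_aux map snd].
  - rewrite app_nil_r, <- covers_spec. destruct (covers X seen); split; try easy.
    + eauto.
    + now intros [].
  - destruct (covers X seen) eqn:C.
    + apply covers_spec in C. split; [|eauto]. intros _. now apply incl_appl.
    + rewrite IH. split; intros H x Hx; specialize (H x Hx);
        cbn in *; rewrite in_app_iff in *; cbn in *; tauto.
Qed.

Lemma arrival_aux_le G X v lb seen t steps a :
  valid_steps G v lb steps -> t <= S (tg_L G) ->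
  arrival_aux X seen t steps = Some a -> a <= S (tg_L G).
Proof.
  revert v lb seen t. induction steps as [|[t1 w] l IH]; intros v lb seen t V Ht; cbn.
  - destruct (covers X seen); intro E; now inversion E; subst.
  - destruct V as (_ & Hle & _ & V). destruct (covers X seen); intro E.
    + now inversion E; subst.
    + eapply IH in E; eauto. lia.
Qed.

Lemma valid_steps_weaken G v lb lb' steps :
  lb' <= lb -> valid_steps G v lb steps -> valid_steps G v lb' steps.
Proof. destruct steps as [|[t w] l]; cbn; intuition lia. Qed.

Section DynamicProgramme.

Variables (G : tgraph) (X : list nat).

Definition visit (R u : nat) : nat := clear R (target_bit X u).

Lemma visit_le R u : visit R u <= R.
Proof. apply clear_le. Qed.

Definition represents_unseen (R : nat) (seen : list nat) : Prop :=
  forall i, Nat.testbit R i = (i <? length X) && negb (existsb (Nat.eqb (nth i X 0)) seen).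

Lemma represents_unseen_nil : represents_unseen (2 ^ length X - 1) [].
Proof.
  intro i. cbn [existsb negb]. rewrite andb_true_r.
  replace (2 ^ length X - 1) with (Nat.ones (length X)) by (rewrite Nat.ones_equiv; lia).
  destruct (Nat.ltb_spec i (length X)).
  - now apply Nat.ones_spec_low.
  - now apply Nat.ones_spec_high.
Qed.

Lemma represents_unseen_cons R seen w :
  NoDup X -> represents_unseen R seen -> represents_unseen (visit R w) (w :: seen).
Proof.
  intros ND HR i. cbn [existsb]. unfold visit.
  destruct (in_dec Nat.eq_dec w X) as [Hw|Hw].
  - destruct (In_nth _ _ 0 Hw) as (j & Hj & <-).
    rewrite target_bit_nth, testbit_clear, HR by trivial.
    destruct (Nat.ltb_spec i (length X)); [|reflexivity].
    destruct (Nat.eqb_spec j i) as [->|N].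
    + rewrite Nat.eqb_refl. cbn. now rewrite andb_false_r.
    + destruct (Nat.eqb_spec (nth i X 0) (nth j X 0)) as [E|_].
      * apply NoDup_nth in E; trivial; lia.
      * cbn. now rewrite andb_true_r.
  - rewrite target_bit_not_in, clear_0_r, HR by trivial.
    destruct (Nat.ltb_spec i (length X)); [|reflexivity].
    destruct (Nat.eqb_spec (nth i X 0) w) as [<-|_]; [|reflexivity].
    exfalso. now apply Hw, nth_In.
Qed.

Lemma covers_represents_unseen R seen :
  represents_unseen R seen -> covers X seen = (R =? 0).
Proof.
  intro HR. destruct (Nat.eqb_spec R 0) as [->|N].
  - apply forallb_forall. intros x Hx.
    destruct (In_nth _ _ 0 Hx) as (j & Hj & <-).
    specialize (HR j). rewrite Nat.bits_0 in HR.
    destruct (Nat.ltb_spec j (length X)); [|lia].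
    destruct (existsb _ _); [reflexivity|discriminate].
  - apply not_true_is_false. intro C. apply N, Nat.bits_inj. intro i.
    rewrite HR, Nat.bits_0.
    destruct (Nat.ltb_spec i (length X)) as [Hi|]; [|reflexivity].
    unfold covers in C. rewrite forallb_forall in C.
    now rewrite (C _ (nth_In _ 0 Hi)).
Qed.

Fixpoint mask_arrival (R t : nat) (steps : list (nat * nat)) : option nat :=
  if R =? 0 then Some t
  else match steps with
       | [] => None
       | (t1, u) :: l => mask_arrival (visit R u) (S t1) l
       end.

Lemma arrival_aux_mask R seen t steps :
  NoDup X -> represents_unseen R seen -> arrival_aux X seen t steps = mask_arrival R t steps.
Proof.
  intro ND. revert R seen t. induction steps as [|[t1 u] l IH]; intros R seen t HR;
    cbn; rewrite (covers_represents_unseen _ _ HR); [reflexivity|].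
  destruct (R =? 0); [reflexivity|]. now apply IH, represents_unseen_cons.
Qed.

Lemma mask_arrival_done t steps : mask_arrival 0 t steps = Some t.
Proof. now destruct steps. Qed.

(* In the next two definitions [f] evaluates the states at time [t + 1]. *)
Definition move_value (f : nat -> nat -> nat) (t v R u : nat) : nat :=
  f u (visit R u) * edge_bit G t v u.

(* Waiting at [v] competes with moving to the vertices below [m]; the summand [1 - R] is [1] exactly
   when no target remains. *)
Definition best_move (f : nat -> nat -> nat) (t v R m : nat) : nat * nat :=
  argmax (move_value f t v R) (f v R + (1 - R), v) m.

(* At vertex [v] at time [L + 2 - r] with the set [R] of targets left, [slack r v R] is
   [L + 2 - a] for the least arrival time [a], and [0] if no continuation visits [R]. *)
Fixpoint slack (r v R : nat) : nat :=
  match r with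
  | 0 => 0
  | S r => fst (best_move (slack r) (S (tg_L G - r)) v R (tg_n G))
  end.

Definition choice (r v R : nat) : nat :=
  snd (best_move (slack r) (S (tg_L G - r)) v R (tg_n G)).

Fixpoint extract (r v R : nat) : list (nat * nat) :=
  match r with
  | 0 => []
  | S r =>
      let u := choice r v R in
      if u =? v then extract r v R
      else (S (tg_L G - r), u) :: extract r u (visit R u)
  end.

Lemma slack_wait r v R : slack r v R + (1 - R) <= slack (S r) v R.
Proof. exact (proj1 (argmax_spec _ (slack r v R + (1 - R), v) _)). Qed.

Lemma slack_move r v R u :
  u < tg_n G -> tg_edge G (S (tg_L G - r)) v u = true ->
  slack r u (visit R u) <= slack (S r) v R.
Proof.
  intros Hu E.
  destruct (argmax_spec (move_value (slack r) (S (tg_L G - r)) v R)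
              (slack r v R + (1 - R), v) (tg_n G)) as (_ & Hmax & _).
  specialize (Hmax u Hu). unfold move_value at 1, edge_bit in Hmax.
  now rewrite E, Nat.mul_1_r in Hmax.
Qed.

Lemma choice_spec r v R :
  choice r v R = v /\ slack (S r) v R = slack r v R + (1 - R) \/
  (let u := choice r v R in
   u < tg_n G /\ slack r v R + (1 - R) < slack (S r) v R /\
   tg_edge G (S (tg_L G - r)) v u = true /\ slack (S r) v R = slack r u (visit R u)).
Proof.
  unfold choice. cbn [slack]. unfold best_move.
  destruct (argmax_spec (move_value (slack r) (S (tg_L G - r)) v R)
              (slack r v R + (1 - R), v) (tg_n G)) as (_ & _ & [E|(Hlt & Hinit & E)]).
  - left. now rewrite E.
  - right. cbn zeta. set (p := argmax _ _ _) in *. cbn [fst] in Hinit.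
    unfold move_value, edge_bit in E. destruct (tg_edge _ _ _ _); [|lia].
    rewrite Nat.mul_1_r in E. auto.
Qed.

Lemma slack_le r v R : slack r v R <= r.
Proof.
  revert v R. induction r as [|r IH]; intros v R; [reflexivity|].
  destruct (choice_spec r v R) as [(_ & ->)|(_ & _ & _ & ->)].
  - specialize (IH v R). lia.
  - apply Nat.le_le_succ_r, IH.
Qed.

Lemma choice_lt r v R : v < tg_n G -> choice r v R < tg_n G.
Proof. intro Hv. destruct (choice_spec r v R) as [(-> & _)|(Hu & _)]; trivial. Qed.

Lemma slack_done r v : slack r v 0 = r.
Proof.
  revert v. induction r as [|r IH]; intro v; [reflexivity|].
  pose proof (slack_wait r v 0). pose proof (slack_le (S r) v 0). specialize (IH v). lia.
Qed.

Lemma extract_done r v : extract r v 0 = [].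
Proof.
  induction r as [|r IH]; [reflexivity|]. cbn [extract].
  destruct (choice_spec r v 0) as [(-> & _)|(_ & Hlt & _)].
  - now rewrite Nat.eqb_refl.
  - rewrite !slack_done in Hlt. lia.
Qed.

Lemma slack_complete r t v R steps a :
  tgraph_wf G -> 1 <= t -> t + r = 2 + tg_L G ->
  valid_steps G v t steps -> mask_arrival R t steps = Some a ->
  2 + tg_L G - a <= slack r v R.
Proof.
  intros WF. revert t v R steps.
  induction r as [|r IH]; intros t v R steps Ht Hr V E.
  - destruct steps as [|[t1 w] l]; cbn in V, E; [|lia].
    destruct (R =? 0); [|discriminate]. injection E as <-. lia.
  - destruct (Nat.eq_dec R 0) as [->|N].
    { rewrite mask_arrival_done in E. injection E as <-. rewrite slack_done. lia. }
    apply Nat.eqb_neq in N. destruct steps as [|[t1 w] l]; cbn in E; rewrite N in E;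
      [discriminate|].
    destruct V as (Hlb & Hle & Hedge & V).
    destruct (Nat.eq_dec t1 t) as [->|Nt].
    + replace t with (S (tg_L G - r)) in Hedge by lia.
      destruct (proj1 WF _ _ _ Hedge) as (_ & _ & Hw & _).
      rewrite <- (slack_move r v R w Hw Hedge).
      apply (IH (S t) w _ l); trivial; lia.
    + transitivity (slack r v R); [|pose proof (slack_wait r v R); lia].
      apply (IH (S t) v R ((t1, w) :: l)); cbn; try rewrite N; repeat split; trivial; lia.
Qed.

Lemma extract_sound r t v R :
  tgraph_wf G -> 1 <= t -> t + r = 2 + tg_L G -> 0 < slack r v R ->
  valid_steps G v t (extract r v R) /\
  mask_arrival R t (extract r v R) = Some (2 + tg_L G - slack r v R).
Proof.
  intros WF. revert t v R.
  induction r as [|r IH]; intros t v R Ht Hr Hs; [cbn in Hs; lia|].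
  destruct (Nat.eq_dec R 0) as [->|N].
  { rewrite extract_done, slack_done, mask_arrival_done. split; [exact I|f_equal; lia]. }
  cbn [extract]. destruct (choice_spec r v R) as [(-> & E)|(_ & _ & Hedge & E)].
  - rewrite Nat.eqb_refl. replace (1 - R) with 0 in E by lia. rewrite Nat.add_0_r in E.
    rewrite E in *.
    destruct (IH (S t) v R ltac:(lia) ltac:(lia) Hs) as (V & A).
    split; [eapply valid_steps_weaken; [|exact V]; lia|].
    rewrite <- A. destruct (extract r v R) as [|[? ?] ?]; cbn;
      now rewrite (proj2 (Nat.eqb_neq _ _) N).
  - set (u := choice r v R) in *. rewrite E in *.
    destruct (proj1 WF _ _ _ Hedge) as (Hle & _ & _ & Huv).
    destruct (Nat.eqb_spec u v); [congruence|].
    replace (S (tg_L G - r)) with t in * by lia.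
    destruct (IH (S t) u (visit R u) ltac:(lia) ltac:(lia) Hs) as (V & A).
    cbn. rewrite (proj2 (Nat.eqb_neq _ _) N). repeat split; trivial; lia.
Qed.

End DynamicProgramme.

Section Instance.

Variable I : instance.

Hypothesis wf : instance_wf I.

Local Notation G := (i_G I).
Local Notation X := (i_X I).
Local Notation L := (tg_L (i_G I)).

Hypothesis lifetime_pos : 1 <= L.

Definition start_mask : nat := visit X (2 ^ i_k I - 1) (i_s I).

Definition best_slack : nat := slack G X (S L) (i_s I) start_mask.

Definition best_tour : list (nat * nat) := extract G X (S L) (i_s I) start_mask.

Lemma arrival_start_mask t steps :
  arrival X (i_s I) t steps = mask_arrival X start_mask t steps.
Proof.
  destruct wf as (_ & _ & ND & _).
  apply arrival_aux_mask; [trivial|].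
  apply represents_unseen_cons; [trivial|apply represents_unseen_nil].
Qed.

Lemma tour_arrival steps :
  tour G (i_s I) 1 X steps <->
  valid_steps G (i_s I) 1 steps /\ exists a, arrival X (i_s I) 1 steps = Some a.
Proof.
  destruct wf as (_ & Hs & _). unfold tour, strict_walk, arrival.
  rewrite arrival_aux_defined. unfold incl. cbn. intuition lia.
Qed.

Lemma best_slack_complete steps a :
  valid_steps G (i_s I) 1 steps -> arrival X (i_s I) 1 steps = Some a ->
  2 + L - a <= best_slack.
Proof.
  intros V A. rewrite arrival_start_mask in A.
  apply (slack_complete G X (S L) 1 _ _ steps); trivial. apply wf.
Qed.

Lemma best_tour_optimal : 0 < best_slack -> optimal_solution I best_tour.
Proof.
  intro Hpos.
  destruct (extract_sound G X (S L) 1 (i_s I) start_mask (proj1 wf)) as (V & A); try trivial.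
  fold best_tour best_slack in V, A. rewrite <- arrival_start_mask in A. split.
  - apply tour_arrival. eauto.
  - intros steps' T a a' Ea Ea'. apply tour_arrival in T as (V' & _).
    pose proof (best_slack_complete _ _ V' Ea').
    assert (2 + L - best_slack = a) by congruence. lia.
Qed.

Lemma yes_instance_best_slack : yes_instance I <-> 0 < best_slack.
Proof.
  split.
  - intros (steps & T). apply tour_arrival in T as (V & a & A).
    pose proof (best_slack_complete _ _ V A).
    assert (a <= S L) by (eapply (arrival_aux_le G X _ _ _ 1); eauto; lia). lia.
  - intro Hpos. exists best_tour. now apply best_tour_optimal.
Qed.

End Instance.

(** * Straight-line code *)

Definition code_at (P : program) (p : nat) (l : program) : Prop :=
  forall i x, nth_error l i = Some x -> nth_error P (p + i) = Some x.

Lemma code_at_app P p l1 l2 :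
  code_at P p (l1 ++ l2) -> code_at P p l1 /\ code_at P (p + length l1) l2.
Proof.
  intro C. split; intros i x E.
  - apply C. rewrite nth_error_app1; trivial. apply nth_error_Some. congruence.
  - rewrite <- Nat.add_assoc. apply C. rewrite nth_error_app2 by lia.
    rewrite <- E. f_equal. lia.
Qed.

Lemma code_at_cons P p i l :
  code_at P p (i :: l) -> nth_error P p = Some i /\ code_at P (S p) l.
Proof.
  intro C. split.
  - rewrite <- (Nat.add_0_r p). now apply C.
  - intros j x E. replace (S p + j) with (p + S j) by lia. now apply C.
Qed.

Lemma upd_eq (m : nat -> nat) a v : upd m a v a = v.
Proof. unfold upd. now rewrite Nat.eqb_refl. Qed.

Lemma upd_neq (m : nat -> nat) a v x : x <> a -> upd m a v x = m x.
Proof. intro Hx. unfold upd. now rewrite (proj2 (Nat.eqb_neq _ _) Hx). Qed.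

Lemma upd_le (m : nat -> nat) a v M x : v <= M -> m x <= M -> upd m a v x <= M.
Proof. unfold upd. now destruct (x =? a). Qed.

Lemma exec_add P a b st : exec P (a + b) st = exec P b (exec P a st).
Proof. revert st; induction a; intro st; cbn; auto. Qed.

Definition effect (i : instr) (m : nat -> nat) : option (nat * nat) :=
  match i with
  | IConst a c => Some (a, c)
  | IAdd a b c => Some (a, m b + m c)
  | ISub a b c => Some (a, m b - m c)
  | IMul a b c => Some (a, m b * m c)
  | IDiv a b c => Some (a, m b / m c)
  | IMod a b c => Some (a, m b mod m c)
  | ILoad a b => Some (a, m (m b))
  | IStore a b => Some (m a, m b)
  | IJmpZ _ _ | IJmpLt _ _ _ | IHalt => None
  end.

Section BoundedRuns.

Variable B : nat.

Definition reach (P : program) (p : nat) (m : nat -> nat) (T p' : nat) (m' : nat -> nat) : Prop :=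
  exec P T (MState p m) = MState p' m' /\
  forall j, j < T -> written_value P (exec P j (MState p m)) <= B.

Lemma reach_refl P p m : reach P p m 0 p m.
Proof. split; [reflexivity|lia]. Qed.

Lemma reach_trans P p1 m1 T1 p2 m2 T2 p3 m3 :
  reach P p1 m1 T1 p2 m2 -> reach P p2 m2 T2 p3 m3 -> reach P p1 m1 (T1 + T2) p3 m3.
Proof.
  intros [E1 W1] [E2 W2]. split.
  - now rewrite exec_add, E1.
  - intros j Hj. destruct (Nat.lt_ge_cases j T1); [auto|].
    replace j with (T1 + (j - T1)) by lia.
    rewrite exec_add, E1. apply W2. lia.
Qed.

Lemma reach_step P p m p' m' :
  step P (MState p m) = MState p' m' -> written_value P (MState p m) <= B ->
  reach P p m 1 p' m'.
Proof.
  intros E W. split; [exact E|].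
  intros j Hj. now replace j with 0 by lia.
Qed.

Lemma reach_effect P p m i a v :
  nth_error P p = Some i -> effect i m = Some (a, v) -> v <= B ->
  reach P p m 1 (S p) (upd m a v).
Proof.
  intros E Ei Hv. apply reach_step; unfold step, written_value; cbn [pc mem]; rewrite E;
    destruct i; try discriminate Ei; injection Ei as <- <-; trivial.
Qed.

Lemma reach_jump P p m a l :
  nth_error P p = Some (IJmpZ a l) -> reach P p m 1 (if m a =? 0 then l else S p) m.
Proof.
  intro E. apply reach_step; unfold step, written_value; cbn [pc mem]; rewrite E;
    [reflexivity|apply Nat.le_0_l].
Qed.

Fixpoint block_wp (l : list instr) (m : nat -> nat) (Q : (nat -> nat) -> Prop) : Prop :=
  match l with
  | [] => Q m
  | i :: l =>
      match effect i m with
      | Some (a, v) => v <= B /\ block_wp l (upd m a v) Q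
      | None => False
      end
  end.

Lemma block_wp_app l1 l2 m Q :
  block_wp l1 m (fun m' => block_wp l2 m' Q) -> block_wp (l1 ++ l2) m Q.
Proof.
  revert m. induction l1 as [|i l1 IH]; intros m W; cbn in *; [exact W|].
  destruct (effect i m) as [[a v]|]; [|exact W]. split; [apply W|apply IH, W].
Qed.

Lemma block_wp_sound P p l m Q :
  code_at P p l -> block_wp l m Q ->
  exists m', reach P p m (length l) (p + length l) m' /\ Q m'.
Proof.
  revert p m. induction l as [|i l IH]; intros p m C W; cbn [block_wp length] in *.
  - exists m. rewrite Nat.add_0_r. split; [apply reach_refl|exact W].
  - apply code_at_cons in C as [E C].
    destruct (effect i m) as [[a v]|] eqn:Ei; [|easy]. destruct W as [Hv W].
    destruct (IH (S p) _ C W) as (m' & R & HQ). exists m'.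
    rewrite Nat.add_succ_r. split; [|exact HQ].
    exact (reach_trans _ _ _ 1 _ _ _ _ _ (reach_effect _ _ _ _ _ _ E Ei Hv) R).
Qed.

Lemma block_wp_bounded l m Q :
  block_wp l m Q -> (forall x, m x <= B) ->
  block_wp l m (fun m' => Q m' /\ forall x, m' x <= B).
Proof.
  revert m. induction l as [|i l IH]; intros m W Hm; cbn in *; [auto|].
  destruct (effect i m) as [[a v]|]; [|easy]. destruct W as [Hv W].
  split; [exact Hv|]. apply IH; [exact W|]. intro x. now apply upd_le.
Qed.

Lemma block_wp_double a j m (Q : _ -> Prop) :
  m a * 2 ^ j <= B ->
  (forall m', m' a = m a * 2 ^ j -> (forall x, x <> a -> m' x = m x) -> Q m') ->
  block_wp (repeat (IAdd a a a) j) m Q.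
Proof.
  revert m. induction j as [|j IH]; intros m HB HQ; cbn [repeat block_wp effect Nat.pow] in *.
  - apply HQ; [lia|auto].
  - pose proof (Nat.pow_nonzero 2 j).
    assert (E : upd m a (m a + m a) a * 2 ^ j = m a * (2 * 2 ^ j)) by (rewrite upd_eq; ring).
    split; [nia|]. apply IH; [now rewrite E|].
    intros m' Ea Eo. apply HQ; [congruence|].
    intros x Hx. now rewrite Eo, upd_neq.
Qed.

End BoundedRuns.

Lemma reach_weaken B B' P p m T p' m' :
  B <= B' -> reach B P p m T p' m' -> reach B' P p m T p' m'.
Proof. intros HB [E W]. split; [exact E|]. intros j Hj. rewrite (W j Hj). exact HB. Qed.

(* The cells from [j] on are saved behind the address in cell 1; cell 0 holds 1. *)
Definition save_cells (j c : nat) : list instr :=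
  flat_map (fun j => [IAdd 1 1 0; IStore 1 j]) (seq j c).

Lemma block_wp_save_cells B j c a m (Q : _ -> Prop) :
  m 0 = 1 -> m 1 = a -> 2 <= j -> j + c <= a + 1 -> a + c <= B ->
  (forall i, i < c -> m (j + i) <= B) ->
  (forall m', m' 0 = 1 -> m' 1 = a + c ->
     (forall i, i < c -> m' (a + 1 + i) = m (j + i)) ->
     (forall x, 2 <= x <= a \/ a + c < x -> m' x = m x) -> Q m') ->
  block_wp B (save_cells j c) m Q.
Proof.
  revert j a m. induction c as [|c IH]; intros j a m H0 H1 Hj Hjc HB Hm HQ.
  - apply HQ; trivial; lia.
  - unfold save_cells. cbn [seq flat_map app block_wp effect].
    rewrite H0, H1, upd_eq, (upd_neq _ _ _ j) by lia.
    split; [lia|]. split; [rewrite <- (Nat.add_0_r j); apply Hm; lia|].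
    apply (IH (S j) (a + 1)); try lia.
    + now rewrite !upd_neq by lia.
    + now rewrite upd_neq, upd_eq by lia.
    + intros i Hi. rewrite !upd_neq by lia. rewrite Nat.add_succ_comm. apply Hm. lia.
    + intros m' E0 E1 Saved Kept. apply HQ; trivial; [lia| |].
      * intros [|i] Hi.
        -- now rewrite !Nat.add_0_r, Kept, upd_eq by lia.
        -- replace (a + 1 + S i) with (a + 1 + 1 + i) by lia.
           rewrite Saved, !upd_neq by lia. f_equal. lia.
      * intros x Hx. now rewrite Kept, !upd_neq by lia.
Qed.

(* The cells [1 .. c] are loaded, downwards, from those below the address in cell 0; cell 1, which
   holds the decrement 1, is overwritten last. *)
Fixpoint restore_cells (c : nat) : list instr :=
  match c with
  | 0 => []
  | S c' => ISub 0 0 1 :: ILoad c 0 :: restore_cells c'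
  end.

Lemma block_wp_restore_cells B c a m (Q : _ -> Prop) :
  m 0 = a + S c -> (c = 0 \/ m 1 = 1) -> c < a -> a + c <= B -> (forall x, a <= x -> m x <= B) ->
  (forall m', (forall x, 1 <= x <= c -> m' x = m (a + x)) ->
     (forall x, c < x -> m' x = m x) -> Q m') ->
  block_wp B (restore_cells c) m Q.
Proof.
  revert m. induction c as [|c IH]; intros m H0 H1 Ha HB Hm HQ.
  - apply HQ; [lia|trivial].
  - destruct H1 as [|H1]; [lia|]. cbn [restore_cells block_wp effect].
    rewrite upd_eq, H0, H1, upd_neq by lia.
    replace (a + S (S c) - 1) with (a + S c) by lia.
    split; [lia|]. split; [apply Hm; lia|]. apply IH; try lia.
    + now rewrite upd_neq, upd_eq by lia.
    + destruct c as [|c]; [now left|right]. now rewrite !upd_neq by lia.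
    + intros x Hx. rewrite !upd_neq by lia. now apply Hm.
    + intros m' Loaded Kept. apply HQ.
      * intros x Hx. destruct (Nat.eq_dec x (S c)) as [->|].
        -- now rewrite Kept, upd_eq by lia.
        -- now rewrite Loaded, !upd_neq by lia.
      * intros x Hx. now rewrite Kept, !upd_neq by lia.
Qed.

(** * A language of counted loops *)

Inductive binop := Add | Sub | Mul | Div | Mod.

Definition binop_sem (o : binop) : nat -> nat -> nat :=
  match o with
  | Add => Nat.add
  | Sub => Nat.sub
  | Mul => Nat.mul
  | Div => Nat.div
  | Mod => Nat.modulo
  end.

Definition binop_instr (o : binop) : nat -> nat -> nat -> instr :=
  match o with
  | Add => IAdd
  | Sub => ISub
  | Mul => IMul
  | Div => IDiv
  | Mod => IMod
  end.

Lemma effect_binop o a b c m :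
  effect (binop_instr o a b c) m = Some (a, binop_sem o (m b) (m c)).
Proof. now destruct o. Qed.

Lemma div_le_dividend a b : a / b <= a.
Proof. destruct b; [cbn; lia|]. apply Nat.Div0.div_le_upper_bound. nia. Qed.

Lemma le_pow_of_le M x e : 1 <= e -> x <= M -> x <= M ^ e.
Proof.
  intros He Hx. destruct M as [|M]; [lia|].
  rewrite Hx, <- (Nat.pow_1_r (S M)) at 1. apply Nat.pow_le_mono_r; lia.
Qed.

Lemma binop_sem_le_pow M o x y i j :
  2 <= M -> 1 <= i -> 1 <= j -> x <= M ^ i -> y <= M ^ j -> binop_sem o x y <= M ^ (i + j).
Proof.
  intros HM Hi Hj Hx Hy. rewrite Nat.pow_add_r.
  assert (Hpow : forall e, 1 <= e -> 2 <= M ^ e).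
  { intros e He. transitivity (M ^ 1); [now rewrite Nat.pow_1_r|].
    apply Nat.pow_le_mono_r; lia. }
  pose proof (Hpow i Hi). pose proof (Hpow j Hj).
  assert (Hx' : x <= M ^ i * M ^ j) by nia.
  destruct o; cbn [binop_sem].
  - nia.
  - lia.
  - now apply Nat.mul_le_mono.
  - now rewrite div_le_dividend.
  - now rewrite Nat.Div0.mod_le.
Qed.

Inductive exp (var : Type) :=
| Cst (c : nat)
| Var (x : var)
| Bin (o : binop) (a b : exp var)
| Fetch (a : exp var).

Declare Scope exp_scope.
Delimit Scope exp_scope with exp.
Bind Scope exp_scope with exp.

Inductive cmd (var : Type) :=
| Assign (x : var) (e : exp var)
| Store (a e : exp var)
| Seq (c1 c2 : cmd var)
| When (e : exp var) (c : cmd var)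
| For (i b : var) (c : cmd var).

Arguments Cst {var} c.
Arguments Var {var} x.
Arguments Bin {var} o (a b)%_exp.
Arguments Fetch {var} a%_exp.
Arguments Assign {var} x e%_exp.
Arguments Store {var} (a e)%_exp.
Arguments Seq {var} c1 c2.
Arguments When {var} e%_exp c.
Arguments For {var} i b c.

Notation "a + b" := (Bin Add a b) : exp_scope.
Notation "a - b" := (Bin Sub a b) : exp_scope.
Notation "a * b" := (Bin Mul a b) : exp_scope.
Notation "a / b" := (Bin Div a b) : exp_scope.
Notation "a 'mod' b" := (Bin Mod a b) : exp_scope.

Notation "x ::= e" := (Assign x e) (at level 70).
Notation "c1 ;; c2" := (Seq c1 c2) (at level 80, right associativity).

Section Language.

(* Variables live in cells below [temp0] and temporaries in the cells from [temp0] up to [heap0];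
   the cells from [heap0] on form the heap. Variables and heap cells hold values up to [limit],
   temporaries up to [limit ^ heap0]. *)
Context {var : Type} (cell : var -> nat) (temp0 heap0 limit : nat).

Fixpoint exp_size (e : exp var) : nat :=
  match e with
  | Cst _ => 1
  | Var _ => 2
  | Bin _ a b => exp_size a + exp_size b + 1
  | Fetch a => exp_size a + 1
  end.

Fixpoint comp_exp (t : nat) (e : exp var) : list instr :=
  match e with
  | Cst c => [IConst t c]
  | Var x => [IConst t 0; IAdd t t (cell x)]
  | Bin o a b => comp_exp t a ++ comp_exp (S t) b ++ [binop_instr o t t (S t)]
  | Fetch a => comp_exp t a ++ [ILoad t t]
  end.

Lemma length_comp_exp t e : length (comp_exp t e) = exp_size e.
Proof.
  revert t. induction e as [c|x|o a IHa b IHb|a IHa]; intro t; cbn; trivial;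
    rewrite !length_app, IHa, ?IHb; cbn; lia.
Qed.

Fixpoint cmd_size (c : cmd var) : nat :=
  match c with
  | Assign _ e => exp_size e + 2
  | Store a e => exp_size a + exp_size e + 1
  | Seq c1 c2 => cmd_size c1 + cmd_size c2
  | When e c => exp_size e + (1 + cmd_size c)
  | For _ _ c => 3 + cmd_size c + 4
  end.

Fixpoint comp (p : nat) (c : cmd var) : program :=
  match c with
  | Assign x e => comp_exp temp0 e ++ [IConst (cell x) 0; IAdd (cell x) (cell x) temp0]
  | Store a e => comp_exp temp0 a ++ comp_exp (S temp0) e ++ [IStore temp0 (S temp0)]
  | Seq c1 c2 => comp p c1 ++ comp (p + cmd_size c1) c2
  | When e c =>
      comp_exp temp0 e ++
      IJmpZ temp0 (p + (exp_size e + (1 + cmd_size c))) :: comp (S (p + exp_size e)) c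
  | For i b c =>
      [IConst (cell i) 0; ISub temp0 (cell b) (cell i); IJmpZ temp0 (p + (3 + cmd_size c + 4))] ++
      comp (p + 3) c ++
      [IConst temp0 1; IAdd (cell i) (cell i) temp0; IConst temp0 0; IJmpZ temp0 (S p)]
  end.

Lemma length_comp c p : length (comp p c) = cmd_size c.
Proof.
  revert p. induction c as [x e|a e|c1 IH1 c2 IH2|e c IH|i b c IH]; intro p; cbn;
    rewrite ?length_app; cbn; rewrite ?length_app, ?length_comp_exp, ?IH1, ?IH2, ?IH;
    cbn; lia.
Qed.

Fixpoint eval (rho : var -> nat) (h : nat -> nat) (e : exp var) : nat :=
  match e with
  | Cst c => c
  | Var x => rho x
  | Bin o a b => binop_sem o (eval rho h a) (eval rho h b)
  | Fetch a => h (eval rho h a)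
  end.

Fixpoint fetches_heap (rho : var -> nat) (h : nat -> nat) (e : exp var) : Prop :=
  match e with
  | Cst _ | Var _ => True
  | Bin _ a b => fetches_heap rho h a /\ fetches_heap rho h b
  | Fetch a => fetches_heap rho h a /\ heap0 <= eval rho h a
  end.

Definition set (rho : var -> nat) (x : var) (v : nat) : var -> nat :=
  fun y => if cell y =? cell x then v else rho y.

Fixpoint modifies (c : cmd var) (x : var) : bool :=
  match c with
  | Assign y _ => cell x =? cell y
  | Store _ _ => false
  | Seq c1 c2 => modifies c1 x || modifies c2 x
  | When _ c => modifies c x
  | For i _ c => (cell x =? cell i) || modifies c x
  end.

Definition preserved (c : cmd var) (rho rho' : var -> nat) : Prop :=
  forall x, modifies c x = false -> rho' x = rho x.

(* Loop bounds are variables that the body does not modify; [size] bounds their values. *)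
Variable size : var -> nat.

Fixpoint cost (c : cmd var) : nat :=
  match c with
  | Assign _ e => exp_size e + 2
  | Store a e => exp_size a + exp_size e + 1
  | Seq c1 c2 => cost c1 + cost c2
  | When e c => exp_size e + (1 + cost c)
  | For _ b c => 3 + size b * (cost c + 6)
  end.

Fixpoint wp (c : cmd var) (rho : var -> nat) (h : nat -> nat)
    (Q : (var -> nat) -> (nat -> nat) -> Prop) : Prop :=
  match c with
  | Assign x e =>
      fetches_heap rho h e /\ eval rho h e <= limit /\ Q (set rho x (eval rho h e)) h
  | Store a e =>
      fetches_heap rho h a /\ fetches_heap rho h e /\
      heap0 <= eval rho h a /\ eval rho h e <= limit /\
      Q rho (upd h (eval rho h a) (eval rho h e))
  | Seq c1 c2 => wp c1 rho h (fun rho h => wp c2 rho h Q)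
  | When e c =>
      fetches_heap rho h e /\
      if eval rho h e =? 0 then Q rho h else wp c rho h Q
  | For i b c =>
      rho b <= size b /\
      exists Inv : nat -> (var -> nat) -> (nat -> nat) -> Prop,
        Inv 0 (set rho i 0) h /\
        (forall j rho' h',
           j < rho b -> preserved (For i b c) rho rho' -> rho' i = j -> Inv j rho' h' ->
           wp c rho' h' (fun rho'' h'' => Inv (S j) (set rho'' i (S j)) h'')) /\
        (forall rho' h', preserved (For i b c) rho rho' -> Inv (rho b) rho' h' -> Q rho' h')
  end.

Lemma set_eq rho x v : set rho x v x = v.
Proof. unfold set. now rewrite Nat.eqb_refl. Qed.

Lemma preserved_set c rho rho' x v :
  modifies c x = true -> preserved c rho rho' -> preserved c rho (set rho' x v).
Proof.
  intros Hx Pr y Hy. unfold set. destruct (Nat.eqb_spec (cell y) (cell x)) as [E|]; [|auto].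
  exfalso. clear Pr. revert Hx Hy.
  assert (modifies c x = modifies c y); [|congruence].
  induction c as [z e|a e|c1 IH1 c2 IH2|e c IH|i b c IH]; cbn; congruence.
Qed.

Lemma preserved_trans c rho1 rho2 rho3 :
  preserved c rho1 rho2 -> preserved c rho2 rho3 -> preserved c rho1 rho3.
Proof. intros Pr1 Pr2 x Hx. rewrite Pr2, Pr1; trivial. Qed.

Lemma wp_frame c rho h (Q Q' : _ -> _ -> Prop) :
  wp c rho h Q -> (forall rho' h', preserved c rho rho' -> Q rho' h' -> Q' rho' h') ->
  wp c rho h Q'.
Proof.
  revert rho h Q Q'.
  induction c as [x e|a e|c1 IH1 c2 IH2|e c IH|i b c IH]; intros rho h Q Q' W HQ; cbn in *.
  - destruct W as (Hd & Hv & W). repeat split; trivial. apply HQ; [|exact W].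
    intros y Hy. unfold set. cbn in Hy. now rewrite Hy.
  - destruct W as (Ha & He & Hh & Hv & W). repeat split; trivial.
    apply HQ; [|exact W]. now intros y Hy.
  - apply (IH1 _ _ _ _ W). intros rho1 h1 P1 W1.
    apply (IH2 _ _ _ _ W1). intros rho2 h2 P2. apply HQ.
    intros y Hy. cbn in Hy. apply orb_false_iff in Hy as [Hy1 Hy2].
    now rewrite P2, P1.
  - destruct W as (Hd & W). split; [exact Hd|]. destruct (eval rho h e =? 0).
    + apply HQ; [now intros y Hy|exact W].
    + now apply (IH _ _ _ _ W).
  - destruct W as (Hb & Inv & Init & Body & Exit). split; [exact Hb|].
    exists Inv. repeat split; auto.
Qed.

Fixpoint leaves (e : exp var) : nat :=
  match e with
  | Cst _ | Var _ => 1
  | Bin _ a b => leaves a + leaves b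
  | Fetch a => leaves a
  end.

Fixpoint small_constants (e : exp var) : bool :=
  match e with
  | Cst c => c <=? heap0
  | Var _ => true
  | Bin _ a b => small_constants a && small_constants b
  | Fetch a => small_constants a
  end.

Definition exp_fits (e : exp var) : bool := small_constants e && (S (leaves e) <=? heap0 - temp0).

Fixpoint fits (c : cmd var) : bool :=
  match c with
  | Assign _ e => exp_fits e
  | Store a e => exp_fits a && exp_fits e
  | Seq c1 c2 => fits c1 && fits c2
  | When e c => exp_fits e && fits c
  | For i b c =>
      negb (modifies c i) && negb (modifies c b) && negb (cell b =? cell i) && fits c
  end.

Lemma leaves_pos e : 1 <= leaves e.
Proof. induction e; cbn; lia. Qed.

Hypothesis cell_lt : forall x, cell x < temp0.
Hypothesis two_le_limit : 2 <= limit.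
Hypothesis temp0_lt_heap0 : temp0 < heap0.
Hypothesis heap0_le_limit : heap0 <= limit.

Local Notation B := (limit ^ heap0).

Record represents (rho : var -> nat) (h m : nat -> nat) : Prop := {
  represents_var : forall x, m (cell x) = rho x;
  represents_heap : forall a, heap0 <= a -> m a = h a;
  represents_var_le : forall x, rho x <= limit;
  represents_heap_le : forall a, h a <= limit
}.

Lemma represents_temporaries rho h m m' :
  represents rho h m -> (forall a, a < temp0 \/ heap0 <= a -> m' a = m a) -> represents rho h m'.
Proof.
  intros [Rv Rh Lv Lh] E. split; trivial; intros; rewrite E; auto.
Qed.

Lemma represents_set rho h m x v :
  represents rho h m -> v <= limit -> represents (set rho x v) h (upd m (cell x) v).
Proof.
  intros [Rv Rh Lv Lh] Hv. split; trivial; unfold set.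
  - intro y. unfold upd. destruct (_ =? _); auto.
  - intros a Ha. rewrite upd_neq; [auto|]. pose proof (cell_lt x). lia.
  - intro y. destruct (_ =? _); auto.
Qed.

Lemma represents_upd rho h m a v :
  represents rho h m -> heap0 <= a -> v <= limit -> represents rho (upd h a v) (upd m a v).
Proof.
  intros [Rv Rh Lv Lh] Ha Hv. split; trivial.
  - intro y. rewrite upd_neq; [auto|]. pose proof (cell_lt y). lia.
  - intros x Hx. unfold upd. destruct (_ =? _); auto.
  - intro x. now apply upd_le.
Qed.

Lemma eval_le rho h e :
  small_constants e = true -> (forall x, rho x <= limit) -> (forall a, h a <= limit) ->
  eval rho h e <= limit ^ leaves e.
Proof.
  intros Hc Lv Lh. induction e as [c|x|o a IHa b IHb|a IHa]; cbn in *.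
  - rewrite Nat.mul_1_r. apply Nat.leb_le in Hc. lia.
  - now rewrite Nat.mul_1_r.
  - apply andb_true_iff in Hc as [Hca Hcb].
    apply binop_sem_le_pow; auto using leaves_pos.
  - apply le_pow_of_le; [apply leaves_pos|apply Lh].
Qed.

Lemma block_wp_comp_exp rho h e t m Q :
  small_constants e = true -> temp0 <= t -> t + leaves e <= heap0 ->
  represents rho h m -> fetches_heap rho h e ->
  (forall m', (forall a, a < t \/ heap0 <= a -> m' a = m a) -> m' t = eval rho h e -> Q m') ->
  block_wp B (comp_exp t e) m Q.
Proof.
  revert t m Q. induction e as [c|x|o a IHa b IHb|a IHa];
    intros t m Q Hc Ht HtH Rm Hl HQ; cbn [comp_exp fetches_heap leaves small_constants] in *;
    pose proof Rm as [Rv Rh Lv Lh].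
  - apply Nat.leb_le in Hc. split; [apply le_pow_of_le; lia|]. cbn. apply HQ.
    + intros a Ha. apply upd_neq. lia.
    + apply upd_eq.
  - pose proof (cell_lt x). specialize (Lv x). cbn [block_wp effect].
    rewrite upd_eq, upd_neq, Rv by lia.
    repeat split; [lia|apply le_pow_of_le; lia|]. apply HQ.
    + intros a Ha. now rewrite !upd_neq by lia.
    + apply upd_eq.
  - apply andb_true_iff in Hc as [Hca Hcb]. destruct Hl as [Hla Hlb].
    pose proof (leaves_pos a). pose proof (leaves_pos b).
    apply block_wp_app, IHa; trivial; [lia|]. intros m1 E1 V1.
    apply block_wp_app, IHb; trivial; [lia|lia| |].
    { apply (represents_temporaries _ _ m); trivial. intros x Hx. apply E1. lia. }
    intros m2 E2 V2. cbn [block_wp]. rewrite effect_binop, V2, E2, V1 by lia. split.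
    + etransitivity; [apply (eval_le rho h (Bin o a b)); cbn; now rewrite ?Hca, ?Hcb|].
      apply Nat.pow_le_mono_r; cbn; lia.
    + apply HQ; [|apply upd_eq]. intros x Hx. now rewrite upd_neq, E2, E1 by lia.
  - destruct Hl as [Hla Ha]. pose proof (leaves_pos a).
    apply block_wp_app, IHa; trivial. intros m1 E1 V1.
    cbn [block_wp effect]. rewrite V1, E1, Rh by auto. split; [apply le_pow_of_le; auto; lia|].
    apply HQ; [|apply upd_eq]. intros x Hx. now rewrite upd_neq, E1 by lia.
Qed.

Definition simulates (P : program) (p len time : nat) (rho : var -> nat) (h : nat -> nat)
    (Q : (var -> nat) -> (nat -> nat) -> Prop) : Prop :=
  forall m, represents rho h m ->
  exists T m' rho' h', T <= time /\ reach B P p m T (p + len) m' /\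
    represents rho' h' m' /\ Q rho' h'.

Lemma simulates_block P p l rho h (Q : _ -> _ -> Prop) :
  code_at P p l ->
  (forall m, represents rho h m ->
     block_wp B l m (fun m' => exists rho' h', represents rho' h' m' /\ Q rho' h')) ->
  simulates P p (length l) (length l) rho h Q.
Proof.
  intros C W m Rm. destruct (block_wp_sound _ _ _ _ _ _ C (W m Rm)) as (m' & R & rho' & h' & HQ).
  exists (length l), m', rho', h'. split; [reflexivity|auto].
Qed.

Lemma simulates_seq P p len1 len2 time1 time2 rho h (Q1 Q : _ -> _ -> Prop) :
  simulates P p len1 time1 rho h Q1 ->
  (forall rho' h', Q1 rho' h' -> simulates P (p + len1) len2 time2 rho' h' Q) ->
  simulates P p (len1 + len2) (time1 + time2) rho h Q.
Proof.
  intros S1 S2 m Rm.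
  destruct (S1 m Rm) as (T1 & m1 & rho1 & h1 & HT1 & R1 & Rm1 & HQ1).
  destruct (S2 _ _ HQ1 m1 Rm1) as (T2 & m2 & rho2 & h2 & HT2 & R2 & Rm2 & HQ).
  exists (T1 + T2), m2, rho2, h2. rewrite Nat.add_assoc.
  split; [lia|]. split; [eapply reach_trans; eassumption|auto].
Qed.

Lemma simulates_comp_exp P p e rho h :
  code_at P p (comp_exp temp0 e) -> exp_fits e = true -> fetches_heap rho h e ->
  forall m, represents rho h m ->
  exists m', reach B P p m (exp_size e) (p + exp_size e) m' /\
    represents rho h m' /\ m' temp0 = eval rho h e.
Proof.
  intros C Hf Hl m Rm. apply andb_true_iff in Hf as [Hc Hn]. apply Nat.leb_le in Hn.
  rewrite <- (length_comp_exp temp0 e). apply (block_wp_sound _ _ _ _ _ _ C).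
  apply (block_wp_comp_exp rho h); trivial; [lia|]. intros m' E V. split; [|exact V].
  now apply (represents_temporaries _ _ m).
Qed.

Lemma simulates_assign P p x e rho h (Q : _ -> _ -> Prop) :
  code_at P p (comp p (Assign x e)) -> exp_fits e = true -> wp (Assign x e) rho h Q ->
  simulates P p (cmd_size (Assign x e)) (cost (Assign x e)) rho h Q.
Proof.
  intros C Hf (Hl & Hv & HQ). apply andb_true_iff in Hf as [Hc Hn]. apply Nat.leb_le in Hn.
  change (cost _) with (cmd_size (Assign x e)). rewrite <- (length_comp _ p).
  apply simulates_block; [exact C|]. intros m Rm. cbn [comp].
  apply block_wp_app, (block_wp_comp_exp rho h); trivial; [lia|]. intros m' E V.
  assert (Rm' : represents rho h m') by now apply (represents_temporaries _ _ m).
  cbn [block_wp effect]. pose proof (cell_lt x).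
  rewrite upd_eq, upd_neq, V by lia. cbn [Nat.add].
  repeat split; [lia|apply le_pow_of_le; lia|].
  eexists. exists h. split; [|exact HQ].
  destruct (represents_set _ _ _ x _ Rm' Hv) as [Rv Rh Lv Lh]. split; trivial; intros.
  - rewrite <- Rv. unfold upd. now destruct (_ =? _).
  - rewrite <- Rh by trivial. unfold upd. now destruct (_ =? _).
Qed.

Lemma simulates_store P p a e rho h (Q : _ -> _ -> Prop) :
  code_at P p (comp p (Store a e)) -> exp_fits a = true -> exp_fits e = true ->
  wp (Store a e) rho h Q ->
  simulates P p (cmd_size (Store a e)) (cost (Store a e)) rho h Q.
Proof.
  intros C Hfa Hfe (Hla & Hle & Ha & Hv & HQ).
  apply andb_true_iff in Hfa as [Hca Hna], Hfe as [Hce Hne].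
  apply Nat.leb_le in Hna, Hne.
  change (cost _) with (cmd_size (Store a e)). rewrite <- (length_comp _ p).
  apply simulates_block; [exact C|]. intros m Rm. cbn [comp].
  apply block_wp_app, (block_wp_comp_exp rho h); trivial; [lia|]. intros m1 E1 V1.
  assert (Rm1 : represents rho h m1) by now apply (represents_temporaries _ _ m).
  apply block_wp_app, (block_wp_comp_exp rho h); trivial; [lia|lia|]. intros m2 E2 V2.
  assert (Rm2 : represents rho h m2).
  { apply (represents_temporaries _ _ m1); trivial. intros x Hx. apply E2. lia. }
  cbn [block_wp effect]. rewrite V2, E2, V1 by lia. split; [apply le_pow_of_le; lia|].
  do 2 eexists. split; [|exact HQ]. now apply represents_upd.
Qed.

Lemma simulates_when P p e c rho h (Q : _ -> _ -> Prop) :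
  code_at P p (comp p (When e c)) -> exp_fits e = true -> fetches_heap rho h e ->
  (eval rho h e = 0 -> Q rho h) ->
  (eval rho h e <> 0 -> code_at P (S (p + exp_size e)) (comp (S (p + exp_size e)) c) ->
   simulates P (S (p + exp_size e)) (cmd_size c) (cost c) rho h Q) ->
  simulates P p (cmd_size (When e c)) (cost (When e c)) rho h Q.
Proof.
  intros C Hf Hl HQ0 HQ1 m Rm. cbn [comp] in C. apply code_at_app in C as [Ce C].
  rewrite length_comp_exp in C. apply code_at_cons in C as [Cj Cc].
  destruct (simulates_comp_exp _ _ _ _ _ Ce Hf Hl m Rm) as (m1 & R1 & Rm1 & V1).
  pose proof (reach_jump B _ _ m1 _ _ Cj) as Rj. rewrite V1 in Rj.
  pose proof (reach_trans _ _ _ _ _ _ _ _ _ _ R1 Rj) as R2.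
  destruct (Nat.eqb_spec (eval rho h e) 0) as [E|E]; cbn [cost cmd_size].
  - exists (exp_size e + 1), m1, rho, h. split; [lia|auto].
  - destruct (HQ1 E Cc m1 Rm1) as (T & m2 & rho2 & h2 & HT & R3 & Rm2 & HQ).
    exists (exp_size e + 1 + T), m2, rho2, h2. split; [lia|]. split; [|auto].
    replace (p + _) with (S (p + exp_size e) + cmd_size c) by lia.
    eapply reach_trans; eassumption.
Qed.

Section Loop.

Variables (P : program) (p : nat) (i b : var) (c : cmd var).
Variables (rho : var -> nat) (Inv : nat -> (var -> nat) -> (nat -> nat) -> Prop).

Hypothesis code : code_at P p (comp p (For i b c)).
Hypothesis body_keeps_counter : modifies c i = false.
Hypothesis body_keeps_bound : modifies c b = false.
Hypothesis counter_not_bound : cell b <> cell i.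

Hypothesis body : forall j rho' h',
  j < rho b -> preserved (For i b c) rho rho' -> rho' i = j -> Inv j rho' h' ->
  simulates P (p + 3) (cmd_size c) (cost c) rho' h' (fun rho'' h'' =>
    preserved c rho' rho'' /\ Inv (S j) (set rho'' i (S j)) h'').

Lemma loop_code :
  nth_error P p = Some (IConst (cell i) 0) /\
  code_at P (S p) [ISub temp0 (cell b) (cell i); IJmpZ temp0 (p + cmd_size (For i b c))] /\
  code_at P (p + 3) (comp (p + 3) c) /\
  code_at P (p + 3 + cmd_size c)
    [IConst temp0 1; IAdd (cell i) (cell i) temp0; IConst temp0 0; IJmpZ temp0 (S p)].
Proof.
  pose proof code as C. cbn [comp] in C.
  apply code_at_app in C as [Ct C]. apply code_at_app in C as [Cb Ci].
  apply code_at_cons in Ct as [Cz Ct]. rewrite length_comp in Ci. auto.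
Qed.

Definition loop_state (j : nat) (rho' : var -> nat) (h' : nat -> nat) : Prop :=
  preserved (For i b c) rho rho' /\ rho' i = j /\ rho' b = rho b /\ Inv j rho' h'.

Lemma loop_test j rho' h' m :
  loop_state j rho' h' -> represents rho' h' m ->
  exists m', reach B P (S p) m 2 (if rho b - j =? 0 then p + cmd_size (For i b c) else p + 3) m' /\
    represents rho' h' m'.
Proof.
  intros (_ & Ei & Eb & _) Rm. pose proof Rm as [Rv Rh Lv Lh].
  destruct loop_code as (_ & C & _). apply (code_at_app _ _ [_] [_]) in C as [Cs Cj].
  apply code_at_cons in Cj as [Cj _].
  set (m' := upd m temp0 (rho b - j)).
  destruct (block_wp_sound B _ _ _ m (eq m') Cs) as (? & Rs & <-).
  { cbn. rewrite !Rv, Ei, Eb. split; [|reflexivity].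
    apply le_pow_of_le; [lia|]. specialize (Lv b). lia. }
  exists m'. split.
  - replace (p + 3) with (S (S p + 1)) by lia.
    pose proof (reach_jump B _ _ m' _ _ Cj) as Rj. unfold m' in Rj at 2.
    rewrite upd_eq in Rj. exact (reach_trans _ _ _ _ _ _ _ _ _ _ Rs Rj).
  - apply (represents_temporaries _ _ m); trivial. intros a Ha. apply upd_neq. lia.
Qed.

Lemma loop_increment j rho' h' m :
  S j <= limit -> represents rho' h' m -> rho' i = j ->
  exists m', reach B P (p + 3 + cmd_size c) m 4 (S p) m' /\ represents (set rho' i (S j)) h' m'.
Proof.
  intros Hj Rm Ei. destruct loop_code as (_ & _ & _ & C).
  apply (code_at_app _ _ [_; _; _] [_]) in C as [Cb Cj].
  apply code_at_cons in Cj as [Cj _].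
  pose proof (cell_lt i).
  set (m' := upd (upd (upd m temp0 1) (cell i) (S j)) temp0 0).
  destruct (block_wp_sound B _ _ _ m (eq m') Cb) as (? & Rb & <-).
  { cbn. rewrite upd_eq, upd_neq, (represents_var _ _ _ Rm), Ei, Nat.add_1_r by lia.
    split; [|split]; [| |split; [lia|reflexivity]]; apply le_pow_of_le; lia. }
  exists m'. split.
  - pose proof (reach_jump B _ _ m' _ _ Cj) as Rj. unfold m' in Rj at 2.
    rewrite upd_eq in Rj. exact (reach_trans _ _ _ _ _ _ _ _ _ _ Rb Rj).
  - apply (represents_temporaries _ _ (upd m (cell i) (S j))); [now apply represents_set|].
    intros a Ha. unfold m', upd.
    destruct (Nat.eqb_spec a temp0), (Nat.eqb_spec a (cell i)); trivial; lia.
Qed.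

Lemma loop_simulates d : forall j rho' h' m,
  j + d = rho b -> loop_state j rho' h' -> represents rho' h' m ->
  exists T m' rho'' h'', T <= 2 + d * (cost c + 6) /\
    reach B P (S p) m T (p + cmd_size (For i b c)) m' /\ represents rho'' h'' m' /\
    loop_state (rho b) rho'' h''.
Proof.
  induction d as [|d IH]; intros j rho' h' m Hd St Rm;
    destruct (loop_test _ _ _ _ St Rm) as (m1 & R1 & Rm1).
  - replace j with (rho b) in * by lia. rewrite Nat.sub_diag in R1.
    exists 2, m1, rho', h'. split; [lia|auto].
  - destruct (Nat.eqb_spec (rho b - j) 0) as [|_]; [lia|].
    destruct St as (Pr & Ei & Eb & HI).
    destruct (body j _ _ ltac:(lia) Pr Ei HI m1 Rm1)
      as (T2 & m2 & rho2 & h2 & HT2 & R2 & Rm2 & Pr2 & HI2).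
    assert (Hj : S j <= limit).
    { pose proof (represents_var_le _ _ _ Rm b). lia. }
    destruct (loop_increment j rho2 h2 m2 Hj Rm2) as (m3 & R3 & Rm3).
    { now rewrite Pr2. }
    destruct (IH (S j) (set rho2 i (S j)) h2 m3) as (T4 & m4 & rho4 & h4 & HT4 & R4 & Rm4 & St4);
      [lia| |exact Rm3|].
    { split; [|split; [apply set_eq|split; [|exact HI2]]].
      - apply preserved_set; [cbn; now rewrite Nat.eqb_refl|].
        apply (preserved_trans _ _ rho'); [exact Pr|].
        intros x Hx. cbn in Hx. apply orb_false_iff in Hx as [_ Hx]. auto.
      - unfold set. rewrite (proj2 (Nat.eqb_neq _ _) counter_not_bound).
        now rewrite Pr2. }
    exists (2 + T2 + 4 + T4), m4, rho4, h4. split; [nia|].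
    split; [|auto]. do 3 (eapply reach_trans; [|eassumption]). exact R1.
Qed.

End Loop.

Lemma simulates_for P p i b c rho h (Q : _ -> _ -> Prop) :
  code_at P p (comp p (For i b c)) ->
  modifies c i = false -> modifies c b = false -> cell b <> cell i ->
  (forall rho' h' Q', code_at P (p + 3) (comp (p + 3) c) -> wp c rho' h' Q' ->
     simulates P (p + 3) (cmd_size c) (cost c) rho' h' Q') ->
  wp (For i b c) rho h Q ->
  simulates P p (cmd_size (For i b c)) (cost (For i b c)) rho h Q.
Proof.
  intros C Hi Hb Hbi Sc (Hsize & Inv & Init & Body & Exit) m Rm.
  destruct (loop_code _ _ _ _ _ C) as (Ci & _ & Cc & _).
  pose proof (reach_effect B _ _ m _ _ _ Ci eq_refl (Nat.le_0_l _)) as R1.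
  destruct (loop_simulates P p i b c rho Inv C Hi Hb Hbi) with
    (d := rho b) (j := 0) (rho' := set rho i 0) (h' := h) (m := upd m (cell i) 0)
    as (T & m' & rho' & h' & HT & R & Rm' & Pr & _ & _ & HI).
  - intros j rho' h' Hj Pr Ei HI. apply Sc; [exact Cc|].
    eapply wp_frame; [exact (Body j rho' h' Hj Pr Ei HI)|auto].
  - reflexivity.
  - split; [|split; [apply set_eq|split; [|exact Init]]].
    + apply preserved_set; [cbn; now rewrite Nat.eqb_refl|now intros x Hx].
    + unfold set. now rewrite (proj2 (Nat.eqb_neq _ _) Hbi).
  - apply represents_set; [exact Rm|lia].
  - exists (1 + T), m', rho', h'. split; [cbn; nia|].
    split; [eapply reach_trans; eassumption|auto].
Qed.

Theorem wp_sound c P p rho h (Q : _ -> _ -> Prop) :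
  fits c = true -> code_at P p (comp p c) -> wp c rho h Q ->
  simulates P p (cmd_size c) (cost c) rho h Q.
Proof.
  revert p rho h Q. induction c as [x e|a e|c1 IH1 c2 IH2|e c IH|i b c IH];
    intros p rho h Q Hf C W; cbn [fits] in Hf.
  - now apply simulates_assign.
  - apply andb_true_iff in Hf as [Hfa Hfe]. now apply simulates_store.
  - apply andb_true_iff in Hf as [Hf1 Hf2]. apply code_at_app in C as [C1 C2].
    rewrite length_comp in C2.
    eapply simulates_seq; [exact (IH1 _ _ _ _ Hf1 C1 W)|].
    intros rho' h' W2. exact (IH2 _ _ _ _ Hf2 C2 W2).
  - apply andb_true_iff in Hf as [Hfe Hfc]. destruct W as [Hl W].
    apply simulates_when; trivial; intro E.
    + now rewrite E in W.
    + intro Cc. apply IH; trivial. now rewrite (proj2 (Nat.eqb_neq _ _) E) in W.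
  - rewrite !andb_true_iff, !negb_true_iff in Hf. destruct Hf as [[[Hi Hb] Hbi] Hf].
    apply Nat.eqb_neq in Hbi. apply simulates_for; auto.
Qed.

Lemma wp_seq c1 c2 rho h Q :
  wp c1 rho h (fun rho' h' => wp c2 rho' h' Q) -> wp (Seq c1 c2) rho h Q.
Proof. trivial. Qed.

Lemma wp_assign x e v rho h (Q : _ -> _ -> Prop) :
  fetches_heap rho h e -> eval rho h e = v -> v <= limit -> Q (set rho x v) h ->
  wp (Assign x e) rho h Q.
Proof. intros Hl <- Hv HQ. repeat split; trivial. Qed.

Lemma wp_store a e x v rho h (Q : _ -> _ -> Prop) :
  fetches_heap rho h a -> fetches_heap rho h e -> eval rho h a = x -> eval rho h e = v ->
  heap0 <= x -> v <= limit -> Q rho (upd h x v) ->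
  wp (Store a e) rho h Q.
Proof. intros Hla Hle <- <- Hx Hv HQ. repeat split; trivial. Qed.

Lemma wp_when e c rho h (Q : _ -> _ -> Prop) :
  fetches_heap rho h e -> (eval rho h e = 0 -> Q rho h) ->
  (eval rho h e <> 0 -> wp c rho h Q) ->
  wp (When e c) rho h Q.
Proof. intros Hl HQ W. split; [exact Hl|]. destruct (Nat.eqb_spec (eval rho h e) 0); auto. Qed.

Lemma wp_for i b c rho h (Inv Q : _) :
  rho b <= size b -> Inv 0 (set rho i 0) h ->
  (forall j rho' h',
     j < rho b -> preserved (For i b c) rho rho' -> rho' i = j -> Inv j rho' h' ->
     wp c rho' h' (fun rho'' h'' => Inv (S j) (set rho'' i (S j)) h'')) ->
  (forall rho' h', preserved (For i b c) rho rho' -> Inv (rho b) rho' h' -> Q rho' h') ->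
  wp (For i b c) rho h Q.
Proof. intros Hb Init Body Exit. split; [exact Hb|]. now exists Inv. Qed.

End Language.

Arguments represents_var {var cell heap0 limit rho h m} _ _.

(** * The program *)

Inductive reg :=
| Pointer | Base | Order | Targets | Source | Rows | Masks | States | Index
| Row | Vertex | Mask | Value | Choice | Candidate | Next | Answer | Length.

Definition reg_cell (x : reg) : nat :=
  match x with
  | Pointer => 0
  | Base => 1
  | Order => 2
  | Targets => 3
  | Source => 4
  | Rows => 5
  | Masks => 6
  | States => 7
  | Index => 8
  | Row => 9
  | Vertex => 10
  | Mask => 11
  | Value => 12
  | Choice => 13
  | Candidate => 14
  | Next => 15
  | Answer => 16
  | Length => 17
  end.

Notation temp_start := 18.
Notation heap_start := 64.

Definition constant (c : nat) : exp reg := Cst c.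
Definition contents (x : reg) : exp reg := Var x.
Coercion constant : nat >-> exp.
Coercion contents : reg >-> exp.

(* The low cells, which the variables occupy, are kept at [b], [b + 1], ...: the input cells at
   [b = Base], the output cells at [b = 3 * Base]. *)
Definition relocate (b j : nat) : nat := if j <? heap_start then b + j else j.

Definition relocated (b e : exp reg) : exp reg := e + (1 - (e - (heap_start - 1)%nat)) * b.

Definition input (e : exp reg) : exp reg := Fetch (relocated Base e).

Definition edge_index (t v u : exp reg) : exp reg :=
  4 + Targets + ((t * Order + v) * Order + u).

Definition bit_slot (u : exp reg) : exp reg := 2 * Base + u.

Definition state_index (r v R : exp reg) : exp reg := (r * Order + v) * Masks + R.

Definition slack_slot (i : exp reg) : exp reg := 4 * Base + 2 * i.

Definition choice_slot (i : exp reg) : exp reg := 4 * Base + 2 * i + 1.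

Definition visiting (R u : exp reg) : exp reg :=
  R - (R / Fetch (bit_slot u)) mod 2 * Fetch (bit_slot u).

(* Initially [Base] holds the last address [A + 63] used for low cells, where
   [A = 64 * (L * n ^ 2 + k)]. *)
Definition read_parameters : cmd reg :=
  Base ::= Base - (heap_start - 1)%nat;;
  Order ::= input 0;;
  Source ::= input 2;;
  Targets ::= input 3;;
  Rows ::= (Base / 64 - Targets) / Order / Order + 1.

Definition fill_bits : cmd reg :=
  Masks ::= 1;;
  For Index Targets
    (Store (bit_slot (input (4 + Index))) Masks;;
     Masks ::= Masks + Masks).

Definition try_move : cmd reg :=
  Candidate ::= Fetch (slack_slot (state_index Row Next (visiting Mask Next)))
                * input (edge_index (Rows - (Row + 1)) Vertex Next);;
  When (Candidate - Value)
    (Value ::= Candidate;;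
     Choice ::= Next).

Definition record_best : cmd reg :=
  Store (slack_slot (Index + Order * Masks)) Value;;
  Store (choice_slot Index) Choice.

Definition fill_entry : cmd reg :=
  Row ::= Index / Masks / Order;;
  Vertex ::= (Index / Masks) mod Order;;
  Mask ::= Index mod Masks;;
  Value ::= Fetch (slack_slot Index) + (1 - Mask);;
  Choice ::= Vertex;;
  For Next Order try_move;;
  record_best.

Definition fill_tables : cmd reg :=
  States ::= Rows * Order * Masks;;
  For Index States fill_entry.

Definition emit_step : cmd reg :=
  Store (relocated (3 * Base) (2 + 2 * Length)) (Index + 1);;
  Store (relocated (3 * Base) (3 + 2 * Length)) Next;;
  Length ::= Length + 1;;
  Mask ::= visiting Mask Next;;
  Vertex ::= Next.

Definition follow_choice : cmd reg :=
  Next ::= Fetch (choice_slot (state_index (Rows - (Index + 1)) Vertex Mask));;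
  When ((Next - Vertex) + (Vertex - Next)) emit_step.

Definition extract_tour : cmd reg :=
  Vertex ::= Source;;
  Mask ::= visiting (Masks - 1) Source;;
  Answer ::= Fetch (slack_slot (state_index Rows Vertex Mask));;
  Length ::= 0;;
  For Index Rows follow_choice;;
  Store (3 * Base + 1) Length.

Definition prepare_output : cmd reg :=
  Pointer ::= 3 * Base + heap_start;;
  Base ::= 1.

Definition solve : cmd reg :=
  read_parameters;; fill_bits;; fill_tables;; extract_tour;; prepare_output.

(* No cell is free at the start: the lifetime in cell 1 is turned into an address beyond the input
   and the variables, from which it can be recovered. *)
Definition compute_base : list instr :=
  [IMul 1 1 0; IMul 1 1 0; IAdd 1 1 3] ++ repeat (IAdd 1 1 1) 6.

Definition spill : list instr :=
  compute_base ++ [IStore 1 0; IConst 0 1; IAdd 1 1 0] ++ save_cells 2 (heap_start - 2).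

Definition solve_start : nat := 2 + length spill.

Definition answer_test : nat := solve_start + cmd_size solve.

Definition yes_exit : nat := answer_test + 1 + length (restore_cells (heap_start - 1)) + 1.

Definition no_exit : nat := S yes_exit.

Definition trivial_exit : nat := no_exit + 2.

Definition texp_program : program :=
  [IJmpZ 1 no_exit; IJmpZ 3 trivial_exit] ++ spill ++
  comp reg_cell temp_start solve_start solve ++
  [IJmpZ (reg_cell Answer) no_exit] ++ restore_cells (heap_start - 1) ++ [IConst 0 1; IHalt] ++
  [IConst 0 0; IHalt] ++ [IConst 0 1; IConst 1 0; IHalt].

Lemma texp_program_code :
  code_at texp_program 2 spill /\
  code_at texp_program solve_start (comp reg_cell temp_start solve_start solve) /\
  code_at texp_program answer_test [IJmpZ (reg_cell Answer) no_exit] /\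
  code_at texp_program (answer_test + 1) (restore_cells (heap_start - 1) ++ [IConst 0 1]) /\
  nth_error texp_program yes_exit = Some IHalt.
Proof.
  assert (C : code_at texp_program 0 texp_program) by now intros i x.
  unfold texp_program at 2 in C.
  apply code_at_app in C as [_ C]. apply code_at_app in C as [Csp C].
  apply code_at_app in C as [Cso C]. rewrite length_comp in C.
  apply code_at_app in C as [Ct C].
  change (restore_cells (heap_start - 1) ++ [IConst 0 1; IHalt] ++ ?l)
    with (restore_cells (heap_start - 1) ++ ([IConst 0 1] ++ ([IHalt] ++ l))) in C.
  rewrite app_assoc in C. apply code_at_app in C as [Cr _].
  repeat (split; [assumption|]). reflexivity.
Qed.

Lemma cost_solve (size : reg -> nat) :
  cost size solve =
  166 + size Targets * 38 + size States * (89 + size Order * 125) + size Rows * 138.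
Proof. cbn. ring. Qed.

Ltac evaluate :=
  cbn [eval fetches_heap binop_sem constant contents edge_index bit_slot state_index slack_slot
       choice_slot set reg_cell Nat.eqb].

Tactic Notation "assign" constr(value) :=
  try apply wp_seq; apply wp_assign with (v := value).

Lemma reach_lifetime_test B I :
  reach B texp_program 0 (encode I) 1 (if tg_L (i_G I) =? 0 then no_exit else 1) (encode I).
Proof. exact (reach_jump B texp_program 0 (encode I) 1 no_exit eq_refl). Qed.

Lemma reach_targets_test B I :
  reach B texp_program 1 (encode I) 1 (if i_k I =? 0 then trivial_exit else 2) (encode I).
Proof. exact (reach_jump B texp_program 1 (encode I) 3 trivial_exit eq_refl). Qed.

Definition size_bound (I : instance) : nat :=
  2 ^ i_k I * (tg_L (i_G I) + 2) * ((tg_n (i_G I) + 2) * (tg_n (i_G I) + 2)).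

Section Run.

Variable I : instance.

Hypothesis wf : instance_wf I.

Local Notation G := (i_G I).
Local Notation X := (i_X I).
Local Notation n := (tg_n (i_G I)).
Local Notation L := (tg_L (i_G I)).
Local Notation s := (i_s I).
Local Notation k := (i_k I).

Hypothesis lifetime_pos : 1 <= L.
Hypothesis targets_pos : 1 <= k.

Definition base : nat := 64 * (L * (n * n) + k).

Definition mask_count : nat := 2 ^ k.

Definition state_count : nat := S L * n * mask_count.

Definition word_bound : nat := size_bound I ^ 3.

Definition loop_bound (x : reg) : nat :=
  match x with
  | Order => n
  | Targets => k
  | Rows => S L
  | States => state_count
  | _ => 0
  end.

Local Notation reg_wp := (wp reg_cell heap_start word_bound loop_bound).
Local Notation reg_preserved := (preserved reg_cell).

Lemma source_lt : s < n.
Proof. now destruct wf as (_ & Hs & _). Qed.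

Lemma target_lt i : i < k -> nth i X 0 < n.
Proof. intro Hi. destruct wf as (_ & _ & _ & HX). now apply HX, nth_In. Qed.

Lemma mask_count_pos : 1 <= mask_count.
Proof. apply Nat.neq_0_lt_0, Nat.pow_nonzero. lia. Qed.

Lemma base_large : heap_start + (4 + k + S L * (n * n)) + 4 * S L + n <= base.
Proof.
  pose proof source_lt. unfold base.
  assert (n <= n * n) by nia.
  assert (n * n <= L * (n * n) /\ L <= L * (n * n)) by nia. lia.
Qed.

Lemma word_bound_large :
  4 * base + heap_start <= word_bound /\ n <= word_bound /\ k <= word_bound /\
  S L <= word_bound /\ mask_count <= word_bound /\ state_count <= word_bound.
Proof.
  pose proof source_lt. pose proof (Nat.pow_gt_lin_r 2 k ltac:(lia)).
  unfold word_bound, size_bound, base, state_count, mask_count. set (K := 2 ^ k) in *. clearbody K.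
  assert (9 <= (n + 2) * (n + 2) /\ n * n <= (n + 2) * (n + 2) /\ n <= (n + 2) * (n + 2)) by nia.
  set (N := (n + 2) * (n + 2)) in *.
  assert (6 <= K * (L + 2) /\ k <= K * (L + 2) /\ L + 2 <= K * (L + 2) /\ K <= K * (L + 2))
    by nia.
  assert (S L * n * K <= K * (L + 2) * N).
  { replace (S L * n * K) with (K * S L * n) by ring.
    apply Nat.mul_le_mono; [apply Nat.mul_le_mono_l|]; lia. }
  set (P := K * (L + 2)) in *. clearbody N P.
  assert (L * (n * n) <= P * N) by (apply Nat.mul_le_mono; lia).
  assert (P <= P * N /\ N <= P * N /\ 54 <= P * N) by nia.
  set (q := P * N) in *. clearbody q.
  assert (600 * q <= q ^ 3) by (cbn; nia).
  lia.
Qed.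

Lemma encode_high j :
  encode I (4 + j) =
  if j <? k then nth j X 0
  else if j - k <? L * (n * n) then
    edge_bit G (S ((j - k) / (n * n))) ((j - k) mod (n * n) / n) ((j - k) mod (n * n) mod n)
  else 0.
Proof.
  unfold encode, edge_bit. replace (4 + j - 4) with j by lia.
  replace (4 + j - (4 + k)) with (j - k) by lia.
  change (4 + j <? 4 + k) with (j <? k). cbn [Nat.eqb Nat.add].
  destruct (Nat.ltb_spec j k), (Nat.ltb_spec (j - k) (L * (n * n))),
    (Nat.ltb_spec (S (S (S (S j)))) (S (S (S (S (k + L * (n * n))))))); trivial; lia.
Qed.

Lemma encode_target i : i < k -> encode I (4 + i) = nth i X 0.
Proof. intro Hi. now rewrite encode_high, (proj2 (Nat.ltb_lt _ _) Hi). Qed.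

(* For [t = L] this reads a cell beyond the input, and there are no edges at time [L + 1]. *)
Lemma encode_edge t v u :
  v < n -> u < n -> t <= L ->
  encode I (4 + k + ((t * n + v) * n + u)) = edge_bit G (S t) v u.
Proof.
  intros Hv Hu Ht. rewrite <- Nat.add_assoc, encode_high, Nat.add_comm, Nat.add_sub.
  rewrite (proj2 (Nat.ltb_ge _ _)) by lia.
  assert (Hvu : v * n + u < n * n) by nia.
  replace ((t * n + v) * n + u) with (n * n * t + (v * n + u)) by ring.
  rewrite <- (Nat.div_unique _ (n * n) t (v * n + u)) by trivial.
  rewrite <- (Nat.mod_unique _ (n * n) t (v * n + u)) by trivial.
  rewrite <- (Nat.div_unique (v * n + u) n v u) by lia.
  rewrite <- (Nat.mod_unique (v * n + u) n v u) by lia.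
  destruct (Nat.ltb_spec (n * n * t + (v * n + u)) (L * (n * n))); [reflexivity|].
  unfold edge_bit. destruct (tg_edge G (S t) v u) eqn:E; [|reflexivity].
  apply (proj1 (proj1 wf)) in E. nia.
Qed.

Lemma encode_beyond j : 4 + k + L * (n * n) <= j -> encode I j = 0.
Proof.
  intro Hj. replace j with (4 + (j - 4)) by lia. rewrite encode_high.
  now rewrite !(proj2 (Nat.ltb_ge _ _)) by lia.
Qed.

Lemma encode_le j : encode I j <= word_bound.
Proof.
  pose proof source_lt. pose proof word_bound_large.
  destruct j as [|[|[|[|j]]]]; [unfold encode; cbn [Nat.eqb]; lia..|].
  change (S (S (S (S j)))) with (4 + j). rewrite encode_high.
  destruct (Nat.ltb_spec j k) as [Hj|_]; [pose proof (target_lt j Hj); lia|].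
  destruct (_ <? _); [|lia]. etransitivity; [apply edge_bit_le|lia].
Qed.

Definition state_number (r v R : nat) : nat := (r * n + v) * mask_count + R.

Lemma state_number_decode r v R :
  v < n -> R < mask_count ->
  state_number r v R / mask_count / n = r /\ (state_number r v R / mask_count) mod n = v /\
  state_number r v R mod mask_count = R.
Proof.
  intros Hv HR. unfold state_number.
  rewrite Nat.div_add_l, (Nat.div_small R mask_count), Nat.add_0_r by lia.
  rewrite Nat.div_add_l, (Nat.div_small v n), Nat.add_0_r by lia.
  rewrite (Nat.add_comm (r * n)), (Nat.add_comm _ R), !Nat.Div0.mod_add.
  rewrite !Nat.mod_small by trivial. auto.
Qed.

Lemma state_number_inj r v R r' v' R' :
  v < n -> R < mask_count -> v' < n -> R' < mask_count ->
  state_number r v R = state_number r' v' R' -> r = r' /\ v = v' /\ R = R'.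
Proof.
  intros Hv HR Hv' HR' E.
  pose proof (state_number_decode r v R Hv HR) as Dec. rewrite E in Dec.
  pose proof (state_number_decode r' v' R' Hv' HR') as Dec'. intuition congruence.
Qed.

Lemma state_number_S r v R : state_number (S r) v R = state_number r v R + n * mask_count.
Proof. unfold state_number. ring. Qed.

Lemma state_number_lt_row r v R r' v' R' :
  v < n -> R < mask_count -> r < r' -> state_number r v R < state_number r' v' R'.
Proof.
  intros Hv HR Hr. unfold state_number.
  assert (r * n + v + 1 <= r' * n + v') by nia.
  assert ((r * n + v + 1) * mask_count <= (r' * n + v') * mask_count)
    by now apply Nat.mul_le_mono_r.
  lia.
Qed.

Lemma state_number_lt_count r v R :
  r <= L -> v < n -> R < mask_count -> state_number r v R < state_count.
Proof.
  intros Hr Hv HR. replace state_count with (state_number (S L) 0 0).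
  - apply state_number_lt_row; trivial. lia.
  - unfold state_number, state_count. ring.
Qed.

Lemma state_number_surj i :
  i < state_count ->
  i / mask_count / n <= L /\ (i / mask_count) mod n < n /\ i mod mask_count < mask_count /\
  i = state_number (i / mask_count / n) ((i / mask_count) mod n) (i mod mask_count).
Proof.
  intro Hi. pose proof source_lt. pose proof mask_count_pos.
  repeat split; try (apply Nat.mod_upper_bound; lia).
  - apply Nat.lt_succ_r, Nat.Div0.div_lt_upper_bound, Nat.Div0.div_lt_upper_bound.
    unfold state_count in Hi. lia.
  - unfold state_number. rewrite (Nat.mul_comm _ n), <- Nat.div_mod_eq.
    rewrite (Nat.mul_comm _ mask_count). apply Nat.div_mod_eq.
Qed.

Definition holds_input (h : nat -> nat) : Prop :=
  forall j, j < base -> j <> 1 -> h (relocate base j) = encode I j.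

Definition agree_below (b : nat) (h h' : nat -> nat) : Prop := forall x, x < b -> h' x = h x.

Definition holds_bits (h : nat -> nat) : Prop :=
  forall x, x < n -> h (2 * base + x) = target_bit X x.

Definition holds_edges (h : nat -> nat) : Prop :=
  forall t v u, t <= L -> v < n -> u < n ->
  h (relocate base (4 + k + ((t * n + v) * n + u))) = edge_bit G (S t) v u.

(* The states numbered below [i + n * mask_count] have got their [slack] and, one row behind, those
   below [i] their [choice]. *)
Definition holds_tables (i : nat) (h : nat -> nat) : Prop :=
  (forall r v R, v < n -> R < mask_count -> state_number r v R < i + n * mask_count ->
     h (4 * base + 2 * state_number r v R) = slack G X r v R) /\
  (forall r v R, v < n -> R < mask_count -> state_number r v R < i ->
     h (4 * base + 2 * state_number r v R + 1) = choice G X r v R).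

Definition holds_output (l : list (nat * nat)) (h : nat -> nat) : Prop :=
  forall i, i < length l ->
    (h (relocate (3 * base) (2 + 2 * i)), h (relocate (3 * base) (3 + 2 * i))) = nth i l (0, 0).

Record params (rho : reg -> nat) : Prop := {
  params_base : rho Base = base;
  params_order : rho Order = n;
  params_targets : rho Targets = k;
  params_source : rho Source = s;
  params_rows : rho Rows = S L
}.

Definition keeps_params (c : cmd reg) : bool :=
  forallb (fun x => negb (modifies reg_cell c x)) [Base; Order; Targets; Source; Rows].

Lemma params_preserved c rho rho' :
  reg_preserved c rho rho' -> keeps_params c = true -> params rho -> params rho'.
Proof.
  unfold keeps_params. rewrite forallb_forall. intros Pr K [E1 E2 E3 E4 E5].
  split; rewrite Pr; trivial; apply negb_true_iff, K; cbn; tauto.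
Qed.

Lemma eval_relocated rho h b e :
  eval rho h (relocated b e) = relocate (eval rho h b) (eval rho h e).
Proof.
  set (j := eval rho h e). set (a := eval rho h b).
  change (j + (1 - (j - 63)) * a = relocate a j). unfold relocate.
  destruct (Nat.ltb_spec j heap_start).
  - replace (1 - (j - 63)) with 1 by lia. lia.
  - replace (1 - (j - 63)) with 0 by lia. lia.
Qed.

Lemma eval_input rho h e : eval rho h (input e) = h (relocate (rho Base) (eval rho h e)).
Proof. cbn [input eval]. now rewrite eval_relocated. Qed.

Lemma relocate_ge b j : heap_start <= b -> heap_start <= relocate b j.
Proof. unfold relocate. destruct (Nat.ltb_spec j heap_start); lia. Qed.

Lemma relocate_lt j : j < base -> relocate base j < 2 * base.
Proof. unfold relocate. destruct (Nat.ltb_spec j heap_start); lia. Qed.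

Ltac fetches :=
  repeat split; rewrite ?eval_relocated; try apply relocate_ge; evaluate;
  repeat match goal with
         | |- _ <= _ + _ => apply Nat.le_trans with (2 := Nat.le_add_r _ _)
         end;
  lia.

Lemma read_parameters_wp rho h :
  rho Base = base + (heap_start - 1) -> holds_input h ->
  reg_wp read_parameters rho h (fun rho' h' => params rho' /\ h' = h).
Proof.
  intros Hbase Hin. pose proof base_large. pose proof word_bound_large. pose proof source_lt.
  assign base; [easy|evaluate; lia|lia|].
  assign n; [fetches| |lia|].
  { rewrite eval_input. apply (Hin 0); lia. }
  assign s; [fetches| |lia|].
  { rewrite eval_input. apply (Hin 2); lia. }
  assign k; [fetches| |lia|].
  { rewrite eval_input. apply (Hin 3); lia. }
  assign (S L); [easy| |lia|repeat split].
  evaluate. replace (base / 64) with (L * n * n + k).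
  - now rewrite Nat.add_sub, !Nat.div_mul, Nat.add_1_r by lia.
  - unfold base. rewrite (Nat.mul_comm 64), Nat.div_mul by lia. ring.
Qed.

Record bits_filled (h : nat -> nat) (j : nat) (h' : nat -> nat) : Prop := {
  bits_filled_below : agree_below (2 * base) h h';
  bits_filled_target : forall i, i < j -> h' (2 * base + nth i X 0) = 2 ^ i;
  bits_filled_zero : forall x, 2 * base <= x ->
    (forall i, i < j -> x <> 2 * base + nth i X 0) -> h' x = 0
}.

Lemma bits_filled_step h j h' :
  j < k -> bits_filled h j h' -> bits_filled h (S j) (upd h' (2 * base + nth j X 0) (2 ^ j)).
Proof.
  intros Hj [Below Bits Zero]. split.
  - intros x Hx. rewrite upd_neq by lia. auto.
  - intros i Hi. destruct (Nat.eq_dec i j) as [->|Ni]; [apply upd_eq|].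
    rewrite upd_neq; [apply Bits; lia|]. intro E.
    destruct wf as (_ & _ & ND & _). apply Ni, (proj1 (NoDup_nth X 0) ND);
      [change (length X) with k; lia..|lia].
  - intros x Hx Nx. rewrite upd_neq by (apply Nx; lia). apply Zero; auto.
Qed.

Lemma bits_filled_all h h' :
  bits_filled h k h' -> holds_bits h' /\ forall x, 3 * base <= x -> h' x = 0.
Proof.
  pose proof base_large. intros [_ Bits Zero]. split.
  - intros x Hx. destruct (in_dec Nat.eq_dec x X) as [Hin|Hout].
    + destruct (In_nth _ _ 0 Hin) as (i & Hi & <-).
      rewrite target_bit_nth; [now apply Bits|apply wf|exact Hi].
    + rewrite target_bit_not_in by trivial. apply Zero; [lia|].
      intros i Hi E. apply Hout. replace x with (nth i X 0) by lia. now apply nth_In.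
  - intros x Hx. apply Zero; [lia|]. intros i Hi. pose proof (target_lt i Hi). lia.
Qed.

Lemma fill_bits_wp rho h :
  params rho -> holds_input h -> (forall x, base + heap_start <= x -> h x = 0) ->
  reg_wp fill_bits rho h (fun rho' h' =>
    rho' Masks = mask_count /\ agree_below (2 * base) h h' /\ holds_bits h' /\
    forall x, 3 * base <= x -> h' x = 0).
Proof.
  intros Par Hin Hzero. pose proof base_large. pose proof word_bound_large.
  assign 1; [easy|reflexivity|lia|].
  set (rho1 := set _ rho _ _). assert (Par1 : params rho1) by (split; apply Par).
  apply wp_for with (Inv := fun j rho' h' => rho' Masks = 2 ^ j /\ bits_filled h j h').
  - now rewrite params_targets.
  - split; [reflexivity|]. split; [easy|lia|]. intros x Hx _. apply Hzero. lia.
  - intros j rho' h' Hj Pr Ej (EM & Filled).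
    rewrite params_targets in Hj by trivial.
    destruct (params_preserved _ _ _ Pr eq_refl Par1) as [EB _ _ _ _].
    assert (Hpow : 2 ^ S j <= mask_count) by (apply Nat.pow_le_mono_r; lia).
    cbn [Nat.pow] in Hpow.
    apply wp_seq, wp_store with (x := 2 * base + nth j X 0) (v := 2 ^ j); try easy; try lia.
    + fetches.
    + cbn [bit_slot eval]. rewrite eval_input. evaluate. rewrite EB, Ej.
      rewrite (bits_filled_below _ _ _ Filled), Hin by (try apply relocate_lt; lia).
      now rewrite encode_target.
    + assign (2 ^ S j); [easy|evaluate; rewrite EM; cbn [Nat.pow]; lia|cbn [Nat.pow]; lia|].
      split; [reflexivity|now apply bits_filled_step].
  - intros rho' h' _ (EM & Filled). rewrite params_targets in * by trivial.
    destruct (bits_filled_all _ _ Filled). split; [exact EM|]. now destruct Filled.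
Qed.

Lemma edge_number_lt t v u :
  t <= L -> v < n -> u < n -> 4 + k + ((t * n + v) * n + u) < base.
Proof.
  intros Ht Hv Hu. pose proof base_large.
  assert ((t * n + v) * n + u < S L * (n * n)); [|lia].
  replace (S L * (n * n)) with ((L * n + n) * n) by ring.
  assert (t * n + v + 1 <= L * n + n) by nia.
  assert ((t * n + v + 1) * n <= (L * n + n) * n) by now apply Nat.mul_le_mono_r.
  lia.
Qed.

Lemma holds_input_edges h : holds_input h -> holds_edges h.
Proof.
  intros Hin t v u Ht Hv Hu. rewrite Hin; [now apply encode_edge| |lia].
  now apply edge_number_lt.
Qed.

Lemma holds_edges_agree h h' : agree_below (2 * base) h h' -> holds_edges h -> holds_edges h'.
Proof.
  intros Agree He t v u Ht Hv Hu. rewrite Agree; [now apply He|].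
  now apply relocate_lt, edge_number_lt.
Qed.

Lemma holds_bits_agree h h' : agree_below (3 * base) h h' -> holds_bits h -> holds_bits h'.
Proof.
  intros Agree Hb x Hx. pose proof base_large. rewrite Agree by lia. now apply Hb.
Qed.

Lemma agree_below_weaken b b' h h' : b' <= b -> agree_below b h h' -> agree_below b' h h'.
Proof. intros Hb Agree x Hx. apply Agree. lia. Qed.

Lemma eval_visiting rho h R u :
  rho Base = base -> holds_bits h -> eval rho h u < n ->
  eval rho h (visiting R u) = visit X (eval rho h R) (eval rho h u).
Proof.
  intros EB Hb Hu. cbn [visiting bit_slot eval]. evaluate. now rewrite EB, Hb.
Qed.

Lemma holds_tables_0 h : (forall x, 3 * base <= x -> h x = 0) -> holds_tables 0 h.
Proof.
  intro Hzero. split; [|lia]. intros [|r] v R Hv HR Hlt.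
  - apply Hzero. lia.
  - rewrite state_number_S in Hlt. lia.
Qed.

Lemma holds_tables_step r v R h :
  v < n -> R < mask_count -> holds_tables (state_number r v R) h ->
  holds_tables (S (state_number r v R))
    (upd (upd h (4 * base + 2 * (state_number r v R + n * mask_count)) (slack G X (S r) v R))
       (4 * base + 2 * state_number r v R + 1) (choice G X r v R)).
Proof.
  intros Hv HR [Hs Hc]. rewrite <- state_number_S. split; intros r' v' R' Hv' HR' Hlt.
  - rewrite upd_neq by lia.
    destruct (Nat.eq_dec (state_number r' v' R') (state_number (S r) v R)) as [E|N].
    + rewrite E, upd_eq. now apply state_number_inj in E as (-> & -> & ->).
    + rewrite upd_neq by lia. apply Hs; trivial. rewrite state_number_S in N. lia.
  - destruct (Nat.eq_dec (state_number r' v' R') (state_number r v R)) as [E|N].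
    + rewrite E, upd_eq. now apply state_number_inj in E as (-> & -> & ->).
    + rewrite !upd_neq by lia. apply Hc; trivial. lia.
Qed.

Lemma state_number_lt_next r u R' v R :
  u < n -> R' < mask_count -> state_number r u R' < state_number r v R + n * mask_count.
Proof. intros Hu HR'. rewrite <- state_number_S. now apply state_number_lt_row; [..|lia]. Qed.

Lemma try_move_wp r v R u rho h :
  params rho -> rho Masks = mask_count ->
  rho Row = r -> rho Vertex = v -> rho Mask = R -> rho Next = u ->
  r <= L -> v < n -> R < mask_count -> u < n ->
  holds_bits h -> holds_edges h -> holds_tables (state_number r v R) h ->
  (rho Value, rho Choice) = best_move G X (slack G X r) (S (L - r)) v R u ->
  reg_wp try_move rho h (fun rho' h' =>
    (rho' Value, rho' Choice) = best_move G X (slack G X r) (S (L - r)) v R (S u) /\ h' = h).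
Proof.
  intros [EB EO ET _ ER] EM Er Ev ERm Eu Hr Hv HR Hu Hbits Hedges [Hslack _] Best.
  pose proof base_large. pose proof word_bound_large.
  pose proof (visit_le X R u).
  set (x := move_value G X (slack G X r) (S (L - r)) v R u).
  assert (Hx : x <= r).
  { unfold x, move_value. transitivity (r * 1); [|lia].
    apply Nat.mul_le_mono; [apply slack_le|apply edge_bit_le]. }
  assert (BestS : best_move G X (slack G X r) (S (L - r)) v R (S u) =
                  if rho Value <? x then (x, u) else (rho Value, rho Choice)).
  { unfold best_move in *. cbn [argmax]. now rewrite <- Best. }
  assert (Ex : eval rho h (Fetch (slack_slot (state_index Row Next (visiting Mask Next)))
                           * input (edge_index (Rows - (Row + 1)) Vertex Next)) = x).
  { evaluate. rewrite eval_input, eval_visiting by (trivial; evaluate; lia).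
    evaluate. rewrite EB, EO, ET, ER, EM, Er, Ev, ERm, Eu.
    replace (S L - (r + 1)) with (L - r) by lia.
    change ((r * n + u) * mask_count + visit X R u) with (state_number r u (visit X R u)).
    rewrite Hslack, Hedges by (trivial; try lia; apply state_number_lt_next; lia).
    reflexivity. }
  clearbody x. rewrite BestS. assign x; [fetches|exact Ex|lia|].
  apply wp_when; [easy|evaluate..]; intro Hlt;
    destruct (Nat.ltb_spec (rho Value) x); try lia.
  - now split.
  - assign x; [easy|reflexivity|lia|]. assign u; [easy|exact Eu|lia|]. now split.
Qed.

Lemma record_best_wp r v R rho h :
  params rho -> rho Masks = mask_count -> rho Index = state_number r v R ->
  r <= L -> v < n -> R < mask_count -> holds_tables (state_number r v R) h ->
  (rho Value, rho Choice) = best_move G X (slack G X r) (S (L - r)) v R n ->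
  reg_wp record_best rho h (fun _ h' =>
    holds_tables (S (state_number r v R)) h' /\ agree_below (4 * base) h h').
Proof.
  intros [EB EO _ _ _] EM EI Hr Hv HR Htab Best.
  pose proof base_large. pose proof word_bound_large.
  assert (EV : rho Value = slack G X (S r) v R) by (cbn [slack]; now rewrite <- Best).
  assert (EC : rho Choice = choice G X r v R) by (unfold choice; now rewrite <- Best).
  pose proof (slack_le G X (S r) v R). pose proof (choice_lt G X r v R Hv).
  set (i := state_number r v R) in *.
  apply wp_seq, wp_store with (x := 4 * base + 2 * (i + n * mask_count)) (v := slack G X (S r) v R);
    [easy|easy|evaluate; now rewrite EB, EO, EM, EI|exact EV|lia|lia|].
  apply wp_store with (x := 4 * base + 2 * i + 1) (v := choice G X r v R);
    [easy|easy|evaluate; now rewrite EB, EI|exact EC|lia|lia|].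
  split; [now apply holds_tables_step|].
  intros x Hx. now rewrite !upd_neq by lia.
Qed.

Lemma fill_entry_wp r v R rho h :
  params rho -> rho Masks = mask_count -> rho Index = state_number r v R ->
  r <= L -> v < n -> R < mask_count ->
  holds_bits h -> holds_edges h -> holds_tables (state_number r v R) h ->
  reg_wp fill_entry rho h (fun _ h' =>
    holds_tables (S (state_number r v R)) h' /\ agree_below (4 * base) h h').
Proof.
  intros Par EM EI Hr Hv HR Hbits Hedges Htab.
  pose proof Par as [EB EO _ _ _]. pose proof base_large. pose proof word_bound_large.
  destruct (state_number_decode r v R Hv HR) as (Dr & Dv & DR).
  assert (Hslack : h (4 * base + 2 * state_number r v R) = slack G X r v R).
  { apply Htab; trivial. pose proof mask_count_pos. nia. }
  pose proof (slack_le G X r v R).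
  assign r; [easy|evaluate; now rewrite EI, EM, EO|lia|].
  assign v; [easy|evaluate; now rewrite EI, EM, EO|lia|].
  assign R; [easy|evaluate; now rewrite EI, EM|lia|].
  assign (slack G X r v R + (1 - R)); [fetches|evaluate; now rewrite EB, EI, Hslack|lia|].
  assign v; [easy|reflexivity|lia|].
  set (rho1 := set _ _ _ _). assert (Par1 : params rho1) by (split; apply Par).
  apply wp_seq, wp_for with (Inv := fun u rho' h' =>
    (rho' Value, rho' Choice) = best_move G X (slack G X r) (S (L - r)) v R u /\ h' = h).
  - cbn. lia.
  - now split.
  - intros u rho' h' Hu Pr Eu (Best & ->).
    apply (try_move_wp r v R u); trivial; try (rewrite Pr by reflexivity; trivial).
    + now apply (params_preserved _ _ _ Pr).
    + change (u < rho Order) in Hu. lia.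
  - intros rho' h' Pr (Best & ->). change (rho1 Order) with (rho Order) in Best.
    rewrite EO in Best. apply record_best_wp; trivial.
    + now apply (params_preserved _ _ _ Pr).
    + now rewrite Pr.
    + now rewrite Pr.
Qed.

Lemma fill_tables_wp rho h :
  params rho -> rho Masks = mask_count -> holds_bits h -> holds_edges h ->
  (forall x, 3 * base <= x -> h x = 0) ->
  reg_wp fill_tables rho h (fun _ h' => holds_tables state_count h' /\ agree_below (4 * base) h h').
Proof.
  intros Par EM Hbits Hedges Hzero. pose proof Par as [_ EO _ _ ER].
  pose proof base_large. pose proof word_bound_large.
  assign state_count; [easy|evaluate; now rewrite ER, EO, EM|lia|].
  set (rho1 := set _ _ _ _). assert (Par1 : params rho1) by (split; apply Par).
  apply wp_for with (Inv := fun i rho' h' => holds_tables i h' /\ agree_below (4 * base) h h').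
  - reflexivity.
  - split; [now apply holds_tables_0|easy].
  - intros i rho' h' Hi Pr Ei (Htab & Agree). change (i < state_count) in Hi.
    destruct (state_number_surj i Hi) as (Hr & Hv & HR & E). rewrite E in Htab.
    eapply wp_frame; [apply (fill_entry_wp (i / mask_count / n) ((i / mask_count) mod n)
                                (i mod mask_count)); trivial|].
    + now apply (params_preserved _ _ _ Pr).
    + now rewrite Pr.
    + now rewrite Ei.
    + revert Hbits. apply holds_bits_agree. now apply (agree_below_weaken (4 * base)); [lia|].
    + revert Hedges. apply holds_edges_agree. now apply (agree_below_weaken (4 * base)); [lia|].
    + intros rho'' h'' _ (Htab' & Agree'). rewrite <- E in Htab'. split; [exact Htab'|].
      intros x Hx. now rewrite Agree', Agree.
  - trivial.
Qed.

Lemma relocate_inj b j j' :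
  j < b -> j' < b -> relocate b j = relocate b j' -> j = j'.
Proof.
  unfold relocate.
  destruct (Nat.ltb_spec j heap_start), (Nat.ltb_spec j' heap_start); lia.
Qed.

Definition tables_kept (h h' : nat -> nat) : Prop :=
  forall x, 2 * base <= x < 3 * base \/ 4 * base <= x -> h' x = h x.

Lemma tables_kept_upd h h' j v :
  j < base -> tables_kept h h' -> tables_kept h (upd h' (relocate (3 * base) j) v).
Proof.
  intros Hj Kept x Hx. pose proof base_large. rewrite upd_neq; [now apply Kept|].
  unfold relocate. destruct (Nat.ltb_spec j heap_start); lia.
Qed.

Lemma holds_output_snoc l h t u :
  3 + 2 * length l < base -> holds_output l h ->
  holds_output (l ++ [(t, u)])
    (upd (upd h (relocate (3 * base) (2 + 2 * length l)) t)
       (relocate (3 * base) (3 + 2 * length l)) u).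
Proof.
  intros Hl Out i Hi. rewrite length_app in Hi. cbn [length] in Hi.
  assert (Neq : forall j j', j < base -> j' < base -> j <> j' ->
    relocate (3 * base) j <> relocate (3 * base) j').
  { intros j j' Hj Hj' N E. apply N, (relocate_inj (3 * base)); trivial; lia. }
  destruct (Nat.eq_dec i (length l)) as [->|Ni].
  - rewrite app_nth2, Nat.sub_diag by lia.
    now rewrite upd_eq, upd_neq, upd_eq by (apply Neq; lia).
  - rewrite !upd_neq by (apply Neq; lia). rewrite app_nth1 by lia. apply Out. lia.
Qed.

Record extracting (h : nat -> nat) (j : nat) (rho : reg -> nat) (h' : nat -> nat) : Prop := {
  extracting_vertex : rho Vertex < n;
  extracting_mask : rho Mask < mask_count;
  extracting_tables : tables_kept h h';
  extracting_steps : exists l,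
    rho Length = length l /\ length l <= j /\ holds_output l h' /\
    l ++ extract G X (S L - j) (rho Vertex) (rho Mask) = best_tour I
}.

Lemma emit_step_wp h j l rho h' :
  params rho -> rho Index = j -> j <= L ->
  rho Next < n -> rho Mask < mask_count -> rho Length = length l -> length l <= j ->
  holds_bits h -> tables_kept h h' -> holds_output l h' ->
  l ++ (S j, rho Next) :: extract G X (L - j) (rho Next) (visit X (rho Mask) (rho Next))
    = best_tour I ->
  reg_wp emit_step rho h' (extracting h (S j)).
Proof.
  intros [EB _ _ _ _] Ej Hj Hu HR El Hl Hbits Kept Out Tour.
  pose proof base_large. pose proof word_bound_large.
  pose proof (visit_le X (rho Mask) (rho Next)).
  set (u := rho Next) in *. set (R := rho Mask) in *.
  set (a1 := relocate (3 * base) (2 + 2 * length l)).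
  set (a2 := relocate (3 * base) (3 + 2 * length l)).
  apply wp_seq, wp_store with (x := a1) (v := S j);
    [easy|easy| |evaluate; lia|apply relocate_ge; lia|lia|].
  { rewrite eval_relocated. evaluate. now rewrite EB, El. }
  apply wp_seq, wp_store with (x := a2) (v := u);
    [easy|easy| |easy|apply relocate_ge; lia|lia|].
  { rewrite eval_relocated. evaluate. now rewrite EB, El. }
  set (h2 := upd _ a2 u).
  assert (Kept2 : tables_kept h h2) by (do 2 (apply tables_kept_upd; [lia|]); trivial).
  assign (S (length l)); [easy|evaluate; lia|lia|].
  assign (visit X R u); [fetches| |lia|].
  { rewrite eval_visiting; trivial.
    intros x Hx. rewrite Kept2 by lia. now apply Hbits. }
  assign u; [easy|reflexivity|lia|].
  split; trivial; [cbn; lia|]. exists (l ++ [(S j, u)]). rewrite length_app, <- app_assoc.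
  split; [cbn; lia|]. split; [cbn; lia|].
  split; [apply holds_output_snoc; trivial; lia|exact Tour].
Qed.

Lemma follow_choice_wp h j rho h' :
  params rho -> rho Masks = mask_count -> rho Index = j -> j <= L ->
  holds_bits h -> holds_tables state_count h -> extracting h j rho h' ->
  reg_wp follow_choice rho h' (extracting h (S j)).
Proof.
  intros Par EM Ej Hj Hbits [_ Hchoice] [Hv HR Kept (l & El & Hl & Out & Tour)].
  pose proof Par as [EB EO _ _ ER]. pose proof base_large. pose proof word_bound_large.
  set (v := rho Vertex) in *. set (R := rho Mask) in *.
  replace (S L - j) with (S (L - j)) in Tour by lia. cbn [extract] in Tour.
  replace (S (L - (L - j))) with (S j) in Tour by lia.
  set (u := choice G X (L - j) v R) in *.
  assert (Hu : u < n) by now apply choice_lt.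
  assign u; [fetches| |lia|].
  { evaluate. rewrite EB, EO, EM, ER, Ej. replace (S L - (j + 1)) with (L - j) by lia.
    change (h' (4 * base + 2 * state_number (L - j) v R + 1) = u).
    rewrite Kept by lia. apply Hchoice; trivial. apply state_number_lt_count; trivial. lia. }
  apply wp_when; [easy|evaluate..]; intro Hd; destruct (Nat.eqb_spec u v); try lia.
  - split; trivial. exists l. auto.
  - apply (emit_step_wp h j l); trivial. split; apply Par.
Qed.

Lemma extract_tour_wp rho h :
  params rho -> rho Masks = mask_count ->
  holds_bits h -> holds_tables state_count h ->
  reg_wp extract_tour rho h (fun rho' h' =>
    rho' Answer = best_slack I /\
    h' (3 * base + 1) = length (best_tour I) /\ holds_output (best_tour I) h').
Proof.
  intros Par EM Hbits Htab. pose proof Par as [EB EO _ ES ER].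
  pose proof base_large. pose proof word_bound_large. pose proof source_lt.
  assert (HR : start_mask I < mask_count).
  { pose proof (visit_le X (2 ^ k - 1) s). pose proof mask_count_pos.
    unfold start_mask, mask_count in *. lia. }
  assign s; [easy|exact ES|lia|].
  assign (start_mask I); [fetches| |lia|].
  { rewrite eval_visiting by (trivial; evaluate; lia). evaluate. now rewrite EM, ES. }
  assert (best_slack I <= S L) by apply slack_le.
  assign (best_slack I); [fetches| |lia|].
  { evaluate. rewrite EB, EO, EM, ER. apply Htab; trivial.
    rewrite state_number_S.
    apply Nat.add_lt_mono_r, state_number_lt_count; trivial. }
  assign 0; [easy|reflexivity|lia|].
  set (rho1 := set _ _ Length _). assert (Par1 : params rho1) by (split; apply Par).
  apply wp_seq, wp_for with (Inv := extracting h).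
  - cbn. lia.
  - split; trivial; [easy|]. exists []. now rewrite Nat.sub_0_r.
  - intros j rho' h' Hj Pr Ej Ex. change (j < rho Rows) in Hj.
    apply wp_frame with (Q := extracting h (S j)).
    + apply follow_choice_wp; trivial; [|now rewrite Pr|lia].
      now apply (params_preserved _ _ _ Pr).
    + intros rho'' h'' _ [Hv HR' Kept Steps]. now split.
  - intros rho' h' Pr [_ _ _ (l & El & Hl & Out & Tour)].
    change (rho1 Rows) with (rho Rows) in *. rewrite ER, Nat.sub_diag, app_nil_r in *.
    subst l. destruct (params_preserved _ _ _ Pr eq_refl Par1) as [EB' _ _ _ _].
    apply wp_store with (x := 3 * base + 1) (v := length (best_tour I));
      [easy|easy|evaluate; now rewrite EB'|exact El|lia|lia|].
    split; [now rewrite Pr|]. split; [apply upd_eq|].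
    intros i Hi. change (3 * base + 1) with (relocate (3 * base) 1).
    rewrite !upd_neq; [now apply Out| |];
      intro E; apply relocate_inj in E; lia.
Qed.

Definition solved (rho : reg -> nat) (h : nat -> nat) : Prop :=
  rho Pointer = 3 * base + heap_start /\ rho Base = 1 /\ rho Answer = best_slack I /\
  h (3 * base + 1) = length (best_tour I) /\ holds_output (best_tour I) h.

Lemma solve_wp rho h :
  rho Base = base + (heap_start - 1) -> holds_input h ->
  (forall x, base + heap_start <= x -> h x = 0) ->
  reg_wp solve rho h solved.
Proof.
  intros EB Hin Hzero. pose proof base_large. pose proof word_bound_large.
  apply wp_seq. eapply wp_frame; [now apply read_parameters_wp|].
  intros rho1 h1 _ (Par1 & ->).
  apply wp_seq. eapply wp_frame; [now apply fill_bits_wp|].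
  intros rho2 h2 Pr2 (EM2 & Below2 & Hbits2 & Hzero2).
  apply (params_preserved _ _ _ Pr2 eq_refl) in Par1 as Par2.
  assert (Hedges2 : holds_edges h2)
    by (apply (holds_edges_agree h); trivial; now apply holds_input_edges).
  apply wp_seq. eapply wp_frame; [now apply fill_tables_wp|].
  intros rho3 h3 Pr3 (Htab3 & Below3).
  apply wp_seq. eapply wp_frame; [apply extract_tour_wp|].
  - now apply (params_preserved _ _ _ Pr3).
  - now rewrite Pr3.
  - revert Hbits2. apply holds_bits_agree. now apply (agree_below_weaken (4 * base)); [lia|].
  - exact Htab3.
  - intros rho4 h4 Pr4 (EA & Out).
    assert (EB4 : rho4 Base = base).
    { rewrite Pr4, Pr3 by reflexivity. apply Par2. }
    assign (3 * base + heap_start); [easy|evaluate; now rewrite EB4|lia|].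
    assign 1; [easy|reflexivity|lia|]. now split.
Qed.

Lemma cost_solve_le :
  cost loop_bound solve <= 908 * (2 ^ k * k * L * (n * n)).
Proof.
  rewrite cost_solve. cbn [loop_bound]. unfold state_count, mask_count.
  pose proof source_lt. pose proof (Nat.pow_nonzero 2 k). set (K := 2 ^ k) in *. clearbody K.
  assert (n <= n * n) by nia. set (N := n * n) in *.
  assert (Hentries : S L * n * K * (89 + n * 125) <= 428 * (K * L * N)).
  { transitivity (2 * L * n * K * (214 * n)); [|unfold N; lia].
    apply Nat.mul_le_mono; [|lia]. do 2 apply Nat.mul_le_mono_r. lia. }
  assert (1 <= N /\ L <= L * N /\ L * N <= K * (L * N)) by nia.
  assert (K * (L * N) <= k * (K * (L * N)) /\ k <= k * (K * (L * N))) by nia.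
  replace (K * L * N) with (K * (L * N)) in Hentries by ring.
  replace (K * k * L * N) with (k * (K * (L * N))) by ring. lia.
Qed.

Lemma block_wp_compute_base (Q : _ -> Prop) :
  (forall m, m 1 = base -> (forall x, x <> 1 -> m x = encode I x) -> Q m) ->
  block_wp word_bound compute_base (encode I) Q.
Proof.
  intro HQ. pose proof source_lt. pose proof word_bound_large.
  assert (L * n * n + k <= base) by (unfold base; lia).
  assert (L * n <= L * n * n).
  { rewrite <- (Nat.mul_1_r (L * n)) at 1. apply Nat.mul_le_mono_l. lia. }
  apply block_wp_app. cbn [block_wp effect]. rewrite !upd_eq, !upd_neq by lia.
  change (encode I 0) with n. change (encode I 1) with L. change (encode I 3) with k.
  do 3 (split; [lia|]).
  set (m := upd _ 1 (L * n * n + k)).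
  assert (Ebase : m 1 * 2 ^ 6 = base) by (unfold m, base; rewrite upd_eq; cbn; ring).
  apply block_wp_double; [lia|]. rewrite Ebase. intros m' E1 E. apply HQ; [exact E1|].
  intros x Hx. rewrite E by trivial. unfold m. now rewrite !upd_neq.
Qed.

Lemma block_wp_spill :
  block_wp word_bound spill (encode I) (fun m =>
    m 1 = base + (heap_start - 1) /\ holds_input m /\ forall x, base + heap_start <= x -> m x = 0).
Proof.
  pose proof base_large. pose proof word_bound_large.
  apply block_wp_app, block_wp_compute_base. intros m E1 E.
  apply block_wp_app. cbn [block_wp effect].
  rewrite !upd_eq, (upd_neq _ _ _ 1), (upd_neq _ _ _ 1) by lia.
  rewrite E1, E by lia. change (encode I 0) with n. do 3 (split; [lia|]).
  set (saving := upd _ 1 (base + 1)).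
  assert (Es : forall x, 2 <= x -> saving x = if x =? base then n else encode I x).
  { intros x Hx. unfold saving. rewrite !(upd_neq _ _ _ x) by lia. unfold upd.
    destruct (x =? base); [reflexivity|]. apply E. lia. }
  apply (block_wp_save_cells _ _ _ (base + 1)); try reflexivity; try lia.
  { intros i Hi. rewrite Es by lia. destruct (_ =? _); [lia|apply encode_le]. }
  intros m' _ E1' Saved Kept. split; [lia|]. split.
  - intros j Hj Nj. unfold relocate. destruct (Nat.ltb_spec j heap_start).
    + destruct j as [|[|j]]; [|lia|].
      * now rewrite Nat.add_0_r, Kept, Es, Nat.eqb_refl by lia.
      * replace (base + S (S j)) with (base + 1 + 1 + j) by lia.
        rewrite Saved, Es by lia. destruct (Nat.eqb_spec (2 + j) base); [lia|reflexivity].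
    + rewrite Kept, Es by lia. destruct (Nat.eqb_spec j base); [lia|reflexivity].
  - intros x Hx. rewrite Kept, Es by lia. destruct (Nat.eqb_spec x base); [lia|].
    apply encode_beyond. lia.
Qed.

Lemma decode_steps_relocated l h m :
  h (3 * base + 1) = length l -> holds_output l h ->
  (forall x, 1 <= x -> m x = h (relocate (3 * base) x)) ->
  decode_steps m = l.
Proof.
  intros Hlen Out Hm. unfold decode_steps. rewrite (Hm 1) by lia.
  change (relocate (3 * base) 1) with (3 * base + 1). rewrite Hlen.
  apply nth_ext with (d := (m 2, m 3)) (d' := (0, 0)); rewrite length_map, length_seq;
    [reflexivity|].
  intros i Hi. change (m 2, m 3) with ((fun i => (m (2 + 2 * i), m (3 + 2 * i))) 0).
  rewrite map_nth, seq_nth, !Hm by lia. now apply Out.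
Qed.

Lemma run_to_answer :
  exists T rho h m,
    T <= 1 + 1 + length spill + cost loop_bound solve /\
    reach (word_bound ^ heap_start) texp_program 0 (encode I) T answer_test m /\
    represents reg_cell heap_start word_bound rho h m /\ solved rho h.
Proof.
  pose proof base_large. pose proof word_bound_large.
  destruct texp_program_code as (Cspill & Csolve & _).
  set (B := word_bound ^ heap_start).
  pose proof (reach_lifetime_test B I) as Rlife. pose proof (reach_targets_test B I) as Rtarg.
  rewrite (proj2 (Nat.eqb_neq L 0)) in Rlife by lia.
  rewrite (proj2 (Nat.eqb_neq k 0)) in Rtarg by lia.
  destruct (block_wp_sound _ _ _ _ _ _ Cspill (block_wp_bounded _ _ _ _ block_wp_spill encode_le))
    as (m & Rspill & (EB & Hin & Hzero) & Hm).
  apply (reach_weaken _ B) in Rspill; [|apply le_pow_of_le; lia].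
  destruct (wp_sound reg_cell temp_start heap_start word_bound loop_bound) with
    (c := solve) (P := texp_program) (p := solve_start) (rho := fun x => m (reg_cell x))
    (h := m) (m := m) (Q := solved) as (T & m' & rho & h & HT & Rsolve & Rm & HQ); try lia.
  - intros []; cbn; lia.
  - reflexivity.
  - exact Csolve.
  - now apply solve_wp.
  - now split.
  - exists (1 + 1 + length spill + T), rho, h, m'. split; [lia|]. split; [|auto].
    eapply reach_trans; [|exact Rsolve]. eapply reach_trans; [|exact Rspill].
    eapply reach_trans; eassumption.
Qed.

Lemma run_restore rho h m :
  represents reg_cell heap_start word_bound rho h m -> solved rho h ->
  exists m', reach (word_bound ^ heap_start) texp_program (S answer_test) m 127 yes_exit m' /\
    m' 0 = 1 /\ decode_steps m' = best_tour I.
Proof.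
  intros [Rv Rh _ Lh] (EP & EB & _ & Hlen & Out).
  pose proof base_large. pose proof word_bound_large.
  assert (Hpow : word_bound <= word_bound ^ heap_start) by (apply le_pow_of_le; lia).
  destruct texp_program_code as (_ & _ & _ & Crestore & _).
  destruct (block_wp_sound (word_bound ^ heap_start) _ _ _ m
    (fun m' => m' 0 = 1 /\ forall x, 1 <= x -> m' x = h (relocate (3 * base) x)) Crestore)
    as (m' & R & E & Hm').
  - apply block_wp_app, (block_wp_restore_cells _ _ (3 * base)); try lia.
    + rewrite <- (Rv Pointer) in EP. cbn [reg_cell] in EP. lia.
    + right. rewrite <- (Rv Base) in EB. exact EB.
    + intros x Hx. rewrite Rh by lia. now rewrite Lh.
    + intros m1 Loaded Kept. cbn [block_wp effect]. split; [lia|]. split; [reflexivity|].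
      intros x Hx. rewrite upd_neq by lia. unfold relocate.
      destruct (Nat.ltb_spec x heap_start).
      * rewrite Loaded by lia. apply Rh. lia.
      * rewrite Kept by lia. now apply Rh.
  - exists m'. split; [exact R|]. split; [exact E|]. now apply (decode_steps_relocated _ h).
Qed.

Lemma texp_program_solves :
  exists T p m,
    T <= 2000 * (2 ^ k * k * L * (n * n)) /\
    reach (word_bound ^ heap_start) texp_program 0 (encode I) T p m /\
    nth_error texp_program p = Some IHalt /\
    (best_slack I = 0 -> m 0 = 0) /\
    (best_slack I <> 0 -> m 0 = 1 /\ decode_steps m = best_tour I).
Proof.
  pose proof source_lt. pose proof cost_solve_le.
  destruct texp_program_code as (_ & _ & Ctest & _ & Cyes).
  destruct run_to_answer as (T & rho & h & m & HT & R & Rm & Sol).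
  change (length spill) with 136 in HT.
  assert (1 <= 2 ^ k * k * L * (n * n)).
  { apply Nat.neq_0_lt_0. pose proof (Nat.pow_nonzero 2 k). rewrite <- !Nat.neq_mul_0. lia. }
  apply code_at_cons in Ctest as [Ctest _].
  pose proof (reach_jump (word_bound ^ heap_start) _ _ m _ _ Ctest) as Rtest.
  rewrite (represents_var Rm), (proj1 (proj2 (proj2 Sol))) in Rtest.
  destruct (Nat.eqb_spec (best_slack I) 0) as [E0|E0].
  - exists (T + 1 + 1), (S no_exit), (upd m 0 0). split; [lia|].
    split; [|easy]. eapply reach_trans; [eapply reach_trans; eassumption|].
    now apply reach_effect with (IConst 0 0); [..|lia].
  - destruct (run_restore rho h m Rm Sol) as (m' & Rrestore & Hm').
    exists (T + 1 + 127), yes_exit, m'. split; [lia|].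
    split; [|easy]. eapply reach_trans; [eapply reach_trans; eassumption|exact Rrestore].
Qed.

End Run.

(** * Correctness, running time and word size *)

Definition solves_within (P : program) (C c : nat) (I : instance) : Prop :=
  let n := tg_n (i_G I) in
  let L := tg_L (i_G I) in
  let k := i_k I in
  exists T : nat,
    T <= C * (2 ^ k * k * L * (n * n) + 1) /\
    halted P (exec P T (init_state I)) /\
    (forall j, j < T ->
       written_value P (exec P j (init_state I))
         <= (2 ^ k * (L + 2) * ((n + 2) * (n + 2))) ^ c) /\
    correct_output I (mem (exec P T (init_state I))).

Lemma reach_solves_within P C c I T p m :
  reach (size_bound I ^ c) P 0 (encode I) T p m ->
  nth_error P p = Some IHalt ->
  T <= C * (2 ^ i_k I * i_k I * tg_L (i_G I) * (tg_n (i_G I) * tg_n (i_G I)) + 1) ->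
  correct_output I m -> solves_within P C c I.
Proof.
  intros [E W] Hp HT Hm. exists T. unfold init_state, halted. rewrite E. cbn [pc mem].
  rewrite Hp. auto.
Qed.

Definition texp_program_correct (I : instance) : Prop :=
  solves_within texp_program 2000 (3 * heap_start) I.

Lemma size_bound_pow_pos I c : 1 <= size_bound I ^ c.
Proof.
  apply Nat.neq_0_lt_0, Nat.pow_nonzero. unfold size_bound.
  pose proof (Nat.pow_nonzero 2 (i_k I)). nia.
Qed.

Lemma solves_no_lifetime I : tg_L (i_G I) = 0 -> texp_program_correct I.
Proof.
  intro HL. pose proof (reach_lifetime_test (size_bound I ^ (3 * heap_start)) I) as R.
  rewrite HL in R.
  apply reach_solves_within with (T := 1 + 1) (p := S no_exit) (m := upd (encode I) 0 0).
  - eapply reach_trans; [exact R|]. now apply reach_effect with (IConst 0 0); [..|lia].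
  - reflexivity.
  - lia.
  - split; [|reflexivity]. intros (steps & (Hw & _) & _). lia.
Qed.

Lemma optimal_solution_no_targets I :
  i_s I < tg_n (i_G I) -> 1 <= tg_L (i_G I) -> i_k I = 0 -> optimal_solution I [].
Proof.
  intros Hs HL Hk. apply length_zero_iff_nil in Hk. unfold optimal_solution. rewrite Hk. split.
  - split; [|intros x []]. now repeat split.
  - intros steps _ a a' [= <-] E. destruct steps as [|[? ?] ?]; injection E as <-; lia.
Qed.

Lemma solves_no_targets I :
  instance_wf I -> 1 <= tg_L (i_G I) -> i_k I = 0 -> texp_program_correct I.
Proof.
  intros (_ & Hs & _) HL Hk.
  pose proof (optimal_solution_no_targets I Hs HL Hk) as Opt.
  pose proof (size_bound_pow_pos I (3 * heap_start)).
  set (B := size_bound I ^ (3 * heap_start)) in *.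
  pose proof (reach_lifetime_test B I) as Rlife. pose proof (reach_targets_test B I) as Rtarg.
  rewrite (proj2 (Nat.eqb_neq (tg_L (i_G I)) 0)) in Rlife by lia. rewrite Hk in Rtarg.
  apply reach_solves_within with (T := 1 + 1 + 1 + 1) (p := 2 + trivial_exit)
    (m := upd (upd (encode I) 0 1) 1 0).
  - eapply reach_trans; [eapply reach_trans; [eapply reach_trans; eassumption|]|].
    + now apply reach_effect with (IConst 0 1).
    + now apply reach_effect with (IConst 1 0); [..|lia].
  - reflexivity.
  - lia.
  - split; [easy|]. intro Hno. exfalso. apply Hno. exists []. apply Opt.
Qed.

Lemma solves_proper I :
  instance_wf I -> 1 <= tg_L (i_G I) -> 1 <= i_k I -> texp_program_correct I.
Proof.
  intros wf HL Hk.
  destruct (texp_program_solves I wf HL Hk) as (T & p & m & HT & R & Hp & Hno & Hyes).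
  unfold word_bound in R. rewrite <- Nat.pow_mul_r in R.
  apply reach_solves_within with (1 := R); [exact Hp|lia|].
  unfold correct_output. rewrite (yes_instance_best_slack I wf HL). split; intro Hb.
  - destruct (Hyes ltac:(lia)) as (E & ->). split; [exact E|]. now apply best_tour_optimal.
  - apply Hno. lia.
Qed.

Theorem theorem2 :
  exists (P : program) (C c : nat),
    forall I : instance, instance_wf I ->
      let n := tg_n (i_G I) in
      let L := tg_L (i_G I) in
      let k := i_k I in
      exists T : nat,
        T <= C * (2 ^ k * k * L * (n * n) + 1) /\
        halted P (exec P T (init_state I)) /\
        (forall j, j < T ->
           written_value P (exec P j (init_state I))
             <= (2 ^ k * (L + 2) * ((n + 2) * (n + 2))) ^ c) /\
        correct_output I (mem (exec P T (init_state I))).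
Proof.
  exists texp_program, 2000, (3 * heap_start). intros I wf.
  destruct (Nat.eq_0_gt_0_cases (tg_L (i_G I))) as [HL|HL].
  - now apply solves_no_lifetime.
  - destruct (Nat.eq_0_gt_0_cases (i_k I)) as [Hk|Hk].
    + now apply solves_no_targets.
    + now apply solves_proper.
Qed.
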